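(* Let $A$ be a stable set with $|A|\ge 2$. Then for every formula $\psi(\bar x,\bar y)$ of $L(T)$ there is a quantifier-free formula $\Psi_\psi(\bar y,\bar z)\in L(T)$ such that whenever $B\equiv A$ and $p\in S_*(B)$, there is $\bar d\subseteq B$ such that $\Psi_\psi(\bar y,\bar d)$ defines $p|_\psi$, i.e. $p|_\psi=\{\psi(\bar x,\bar a):\bar a\subseteq B,\ \models\Psi_\psi(\bar a,\bar d)\}$ (together with the negations $\neg\psi(\bar x,\bar a)$ for the remaining $\bar a\subseteq B$).
   Context: Throughout, $T$ is a complete first-order theory in a language $L(T)$ without function symbols, $T$ has quantifier elimination, and $P$ is a unary predicate of $L(T)$. $\mathcal{C}$ is the monster model of $T$; all sets are subsets of $\mathcal{C}$, all models are elementary submodels of $\mathcal{C}$, types are computed in $\mathcal{C}$. Standing hypotheses: (H1) every relation on $P^{\mathcal{C}}$ first-order definable in $\mathcal{C}$ is definable without parameters in $\mathcal{C}|_{P^{\mathcal{C}}}$; (H2) every type over $P^{\mathcal{C}}$ is definable; (H3) every model of $T$ is a stable set. Definitions: a set $A$ is complete if for every formula $\psi(\bar x,\bar y)$ and $\bar b\subseteq A$ with $\models(\exists\bar x\in P)\psi(\bar x,\bar b)$ there is $\bar a\subseteq P^{\mathcal{C}}\cap A$ with $\models\psi(\bar a,\bar b)$. $A\equiv B$ means $\mathrm{Th}(\mathcal{C}|_A)=\mathrm{Th}(\mathcal{C}|_B)$, where $\mathcal{C}|_A$ is the induced $L(T)$-structure on $A$. For complete $A$, $S_*(A)$ is the set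 of types $tp(\bar c/A)$ with $P^{\mathcal{C}}\cap(A\cup\bar c)=P^{\mathcal{C}}\cap A$ and $A\cup\bar c$ complete. $A$ is stable if it is complete and $|S_*(A')|\le|A'|^{|T|}$ for every $A'\equiv A$. For a type $p$, $p|_\psi$ denotes the set of formulas of the form $\pm\psi(\bar x,\bar b)$ in $p$. *)

(* Defs.v *)
From mathcomp Require Import all_boot all_classical.

Set Implicit Arguments.
Unset Strict Implicit.
Unset Printing Implicit Defensive.

Local Open Scope classical_set_scope.
Local Open Scope card_scope.

(* First-order languages with equality and neither function nor constant
   symbols: every subset of a structure carries an induced structure. *)
Record language := Language { symb :> Type; arity : symb -> nat }.

(* Well-scoped de Bruijn syntax: the free variables of a formula of type
   [formula L n] are indexed by ['I_n], and [Fall] binds variable 0. A formula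
   psi(x, y) with |x| = n and |y| = m is a [formula L (n + m)]. *)
Inductive formula (L : language) : nat -> Type :=
| Fbot n : formula L n
| Feq n of 'I_n & 'I_n : formula L n
| Frel n (r : L) of (arity r).-tuple 'I_n : formula L n
| Fimp n of formula L n & formula L n : formula L n
| Fall n of formula L n.+1 : formula L n.

Arguments Fbot {L n}.

Definition Fneg L n (phi : formula L n) : formula L n := Fimp phi Fbot.

Definition sentence L := formula L 0.

Fixpoint qfree L n (phi : formula L n) : bool :=
  match phi with
  | Fimp _ phi1 phi2 => qfree phi1 && qfree phi2
  | Fall _ _ => false
  | _ => true
  end.

(* The set of all formulas of L. Its cardinality |L| + aleph_0 is what is
   denoted |T|, for T a complete theory in L. *)
Definition all_formulas L := {n : nat & formula L n}.

(* Carriers may be empty, since the empty subset of a structure is allowed;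
   models of theories may not, see [model_of]. *)
Record structure (L : language) := Structure {
  carrier :> Type;
  interp : forall r : L, (arity r).-tuple carrier -> Prop }.

Fixpoint sat L (M : structure L) n (phi : formula L n) : n.-tuple M -> Prop :=
  match phi in formula _ n return n.-tuple M -> Prop with
  | Fbot _ => fun=> False
  | Feq _ i j => fun v => tnth v i = tnth v j
  | Frel _ r s => fun v => interp (map_tuple (tnth v) s)
  | Fimp _ phi1 phi2 => fun v => sat phi1 v -> sat phi2 v
  | Fall _ phi1 => fun v => forall x : M, sat phi1 (cons_tuple x v)
  end.

Definition holds L (M : structure L) (phi : sentence L) : Prop :=
  sat phi ([tuple] : 0.-tuple M).

Section Theories.
Variable L : language.
Implicit Types (M : structure L) (T : set (sentence L)).

Definition model_of M T : Prop :=
  inhabited M /\ forall phi, T phi -> holds M phi.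

Definition entails T (phi : sentence L) : Prop :=
  forall M, model_of M T -> holds M phi.

Definition complete_theory T : Prop :=
  (exists M, model_of M T) /\ forall phi, entails T phi \/ entails T (Fneg phi).

Definition quantifier_elimination T : Prop :=
  forall n (phi : formula L n), exists2 theta : formula L n, qfree theta &
    forall M, model_of M T -> forall v : n.-tuple M, sat phi v <-> sat theta v.

End Theories.

Definition card_lt T U (A : set T) (B : set U) : Prop := ~ (B #<= A).

Definition tuple_in U (A : set U) n (a : n.-tuple U) : Prop :=
  forall i, A (tnth a i).

Section Monster.
Variables (L : language) (C : structure L).
Implicit Types (A B : set C).

(* Formulas psi(x, b) in n variables x with a tuple b of parameters from C. *)
Definition pformula n := {m : nat & (formula L (n + m) * m.-tuple C)%type}.

Definition PFormula n m (psi : formula L (n + m)) (b : m.-tuple C) :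
  pformula n := existT _ m (psi, b).

Definition psat n (phi : pformula n) (c : n.-tuple C) : Prop :=
  sat (projT2 phi).1 (cat_tuple c (projT2 phi).2).

Definition pformula_over A n : set (pformula n) :=
  [set phi | tuple_in A (projT2 phi).2].
Arguments pformula_over A {n}.

Definition tp n (c : n.-tuple C) A : set (pformula n) :=
  [set phi | pformula_over A phi /\ psat phi c].

(* Cardinals are represented by types. *)
Definition saturated (kappa : Type) : Prop :=
  forall A, card_lt A [set: kappa] ->
  forall n (p : set (pformula n)), p `<=` pformula_over A ->
    (forall q, finite_set q -> q `<=` p ->
       exists c, forall phi, q phi -> psat phi c) ->
    exists c, forall phi, p phi -> psat phi c.

Definition elementary_on A (f : C -> C) : Prop :=
  forall n (phi : formula L n) (a : n.-tuple C), tuple_in A a ->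
    (sat phi a <-> sat phi (map_tuple f a)).

Definition automorphism (g : C -> C) : Prop :=
  bijective g /\
  forall (r : L) (t : (arity r).-tuple C), interp t <-> interp (map_tuple g t).

Definition strongly_homogeneous (kappa : Type) : Prop :=
  forall A, card_lt A [set: kappa] ->
  forall f, elementary_on A f ->
    exists2 g, automorphism g & forall x, A x -> g x = f x.

(* The monster model, "sufficiently large" being made explicit by the lower
   bound 2 ^ |T| < kappa. It is kappa and not the carrier of C that is required
   to be large, so that T may have finite models. *)
Definition monster (kappa : Type) (T : set (sentence L)) : Prop :=
  [/\ model_of C T, card_lt [set: set (all_formulas L)] [set: kappa],
      saturated kappa & strongly_homogeneous kappa].

Definition induced A : structure L :=
  @Structure L {x : C | A x} (fun r t => interp (map_tuple sval t)).

Definition elem_equiv A B : Prop :=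
  forall phi, holds (induced A) phi <-> holds (induced B) phi.

Definition elementary_submodel A : Prop :=
  forall n (phi : formula L n) (a : n.-tuple (induced A)),
    sat phi a <-> sat phi (map_tuple sval a).

(* p|_psi *)
Definition restrict n m (p : set (pformula n)) (psi : formula L (n + m)) :
  set (pformula n) :=
  [set phi | p phi /\
    exists b, phi = PFormula psi b \/ phi = PFormula (Fneg psi) b].

(* Psi(y, d) defines p|_psi, where p is a complete type over A. *)
Definition defines A n m k (Psi : formula L (m + k)) (d : k.-tuple C)
    (p : set (pformula n)) (psi : formula L (n + m)) : Prop :=
  restrict p psi =
  [set PFormula psi a | a in [set a | tuple_in A a /\ sat Psi (cat_tuple a d)]]
  `|` [set PFormula (Fneg psi) a |
        a in [set a | tuple_in A a /\ ~ sat Psi (cat_tuple a d)]].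

Definition definable_type A n (p : set (pformula n)) : Prop :=
  forall m (psi : formula L (n + m)),
    exists k (Psi : formula L (m + k)) (d : k.-tuple C),
      tuple_in A d /\ defines A Psi d p psi.

Section Predicate.
Variable P : L.

(* P^C. The predicate P is assumed unary where this is used, so that the tuple
   below is the 1-tuple x. *)
Definition Pset : set C := [set x | interp (nseq_tuple (arity P) x)].

Definition complete_set A : Prop :=
  forall n m (psi : formula L (n + m)) (b : m.-tuple C), tuple_in A b ->
    (exists2 x : n.-tuple C, tuple_in Pset x & sat psi (cat_tuple x b)) ->
    exists2 a : n.-tuple C, tuple_in (Pset `&` A) a & sat psi (cat_tuple a b).

(* S_*(A): types of tuples of all finite lengths. *)
Definition Sstar A : set {n : nat & set (pformula n)} :=
  [set p | complete_set A /\ exists n (c : n.-tuple C),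
    [/\ Pset `&` (A `|` range (tnth c)) = Pset `&` A,
        complete_set (A `|` range (tnth c)) &
        p = existT _ n (tp c A)]].

(* The right-hand side of the inequality has cardinality |A'| ^ |T|. *)
Definition stable A : Prop :=
  complete_set A /\
  forall A', elem_equiv A' A ->
    Sstar A' #<= [set f : all_formulas L -> C | range f `<=` A'].

(* Every relation on P^C definable in C without parameters is definable
   without parameters in the structure induced on P^C. *)
Definition P_relations_definable : Prop :=
  forall n (phi : formula L n), exists theta : formula L n,
    forall a : n.-tuple (induced Pset),
      sat phi (map_tuple sval a) <-> sat theta a.

Definition types_over_P_definable : Prop :=
  forall n (c : n.-tuple C), definable_type Pset (tp c Pset).

Definition models_stable : Prop :=
  forall M, elementary_submodel M -> stable M.

End Predicate.
End Monster.

(* Main.v *)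
(* For a definable relation rho(x; a) and demands "some z in P satisfies D(z, x, b)",
   let the rank of a formula theta(x) over B measure how often theta can be split by
   instances of rho while every demand is decided, accepted demands being witnessed
   in P and B. If A is stable then for each rho some D bounds this rank uniformly over
   all B elementarily equivalent to A: otherwise, with 2 ^ |T| = |W|, a full binary
   tree of height Lam, where |2 ^ i| <= |W| for i in Lam but |2 ^ Lam| > |W|, is
   realized in C over a set B of cardinality at most |W| that is elementarily
   equivalent to A, and its more than |W| branches have different types in S_*(B).
   The bound isolates rho-types: a consistent formula over a complete set B has a
   consistent extension, an instance over B of a formula depending only on rho, which
   decides rho over B. Applying the bound also to C itself, stable by (H3), the type
   of c over B is defined by induction on the rank, computed in C, of a definable set
   that contains c. A demand that lowers this rank replaces the set by a smaller one,
   with the parameters of the demand known only up to their isolated type over B.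
   Otherwise, as the set cannot be split by psi, psi(c, a) holds if and only if
   adding psi(x, a) preserves the rank. Finitely many cases are merged using two
   distinct elements of B, and quantifier elimination ends the proof. *)

From HB Require Import structures.
Require Import Defs.
From mathcomp Require Import all_boot all_classical wochoice.

Set Implicit Arguments.
Unset Strict Implicit.
Unset Printing Implicit Defensive.

Local Open Scope classical_set_scope.
Local Open Scope card_scope.

(** Index types of variables grow by [option] when one variable is bound and by sums when blocks are
    joined; [ocase] and [scase] are the matching assignments. *)
Definition ocase T V (z : T) (v : V -> T) (o : option V) : T :=
  if o is Some j then v j else z.

Definition scase T U V (x : U -> T) (v : V -> T) (s : U + V) : T :=
  match s with inl i => x i | inr j => v j end.

(** * Definable relations *)

Section Renaming.
Variable L : language.

Definition lift_ren n m (f : 'I_n -> 'I_m) (i : 'I_n.+1) : 'I_m.+1 :=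
  if unlift ord0 i is Some j then lift ord0 (f j) else ord0.

Fixpoint ren n (phi : formula L n) : forall m, ('I_n -> 'I_m) -> formula L m :=
  match phi in formula _ n return forall m, ('I_n -> 'I_m) -> formula L m with
  | Fbot _ => fun _ _ => Fbot
  | Feq _ i j => fun _ f => Feq L (f i) (f j)
  | Frel _ r s => fun _ f => Frel (map_tuple f s)
  | Fimp _ phi1 phi2 => fun _ f => Fimp (ren phi1 f) (ren phi2 f)
  | Fall _ phi1 => fun _ f => Fall (ren phi1 (lift_ren f))
  end.

Lemma sat_ren (M : structure L) n (phi : formula L n) m (f : 'I_n -> 'I_m)
    (v : m.-tuple M) :
  sat (ren phi f) v <-> sat phi [tuple tnth v (f i) | i < n].
Proof.
elim: phi m f v => {n} [n|n i j|n r s|n phi1 IH1 phi2 IH2|n phi1 IH1] m f v //=.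
- by rewrite !tnth_mktuple.
- suff -> : map_tuple (tnth v) (map_tuple f s) =
      map_tuple (tnth [tuple tnth v (f i) | i < n]) s by [].
  by apply: eq_from_tnth => i; rewrite !tnth_map tnth_ord_tuple.
- by rewrite IH1 IH2.
- suff E x : [tuple tnth (cons_tuple x v) (lift_ren f i) | i < n.+1] =
      cons_tuple x [tuple tnth v (f i) | i < n].
    by split=> H x; move/(_ x): H; rewrite IH1 E.
  apply: eq_from_tnth => i; rewrite tnth_mktuple /lift_ren.
  by case: unliftP => [j|] ->; rewrite ?tnth0 // !tnthS tnth_mktuple.
Qed.

End Renaming.

Section Definability.
Variables (L : language) (C : structure L).

(* X is definable without parameters; its free variables are indexed by V, which
   may be infinite. *)
Definition Def V (X : (V -> C) -> Prop) : Prop :=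
  exists p (phi : formula L p) (f : 'I_p -> V),
    forall v, X v <-> sat phi [tuple v (f i) | i < p].

Lemma Def_ext V (X Y : (V -> C) -> Prop) :
  (forall v, X v <-> Y v) -> Def X -> Def Y.
Proof. by move=> XY [p [phi [f H]]]; exists p, phi, f => v; rewrite -XY. Qed.

Lemma Def_ren V W (f : V -> W) (X : (V -> C) -> Prop) :
  Def X -> Def (fun w => X (w \o f)).
Proof. by move=> [p [phi [g H]]]; exists p, phi, (f \o g) => w; rewrite H. Qed.

Lemma Def_false V : Def (fun _ : V -> C => False).
Proof.
exists 0%N, Fbot.
have f : 'I_0 -> V by case.
by exists f.
Qed.

Lemma Def_imp V (X Y : (V -> C) -> Prop) :
  Def X -> Def Y -> Def (fun v => X v -> Y v).
Proof.
move=> [p [phi [f H]]] [q [psi [g K]]].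
pose h (i : 'I_(p + q)) :=
  match fintype.split i with inl j => f j | inr j => g j end.
exists (p + q)%N, (Fimp (ren phi (lshift q)) (ren psi (@rshift p q))), h => v /=.
have hl i : h (lshift q i) = f i by rewrite /h -/(unsplit (inl i)) unsplitK.
have hr i : h (rshift p i) = g i by rewrite /h -/(unsplit (inr i)) unsplitK.
rewrite !sat_ren H K.
have -> : [tuple v (f i) | i < p] =
    [tuple tnth [tuple v (h i) | i < p + q] (lshift q i) | i < p].
  by apply: eq_from_tnth => i; rewrite !tnth_mktuple hl.
have -> // : [tuple v (g i) | i < q] =
    [tuple tnth [tuple v (h i) | i < p + q] (rshift p i) | i < q].
by apply: eq_from_tnth => i; rewrite !tnth_mktuple hr.
Qed.

Lemma Def_not V (X : (V -> C) -> Prop) : Def X -> Def (fun v => ~ X v).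
Proof. by move=> H; apply: Def_imp => //; apply: Def_false. Qed.

Lemma Def_and V (X Y : (V -> C) -> Prop) :
  Def X -> Def Y -> Def (fun v => X v /\ Y v).
Proof.
move=> HX HY; apply: (@Def_ext _ (fun v => ~ (X v -> ~ Y v))).
  by move=> v; rewrite not_implyE notK.
by apply/Def_not/Def_imp/Def_not.
Qed.

Lemma Def_or V (X Y : (V -> C) -> Prop) :
  Def X -> Def Y -> Def (fun v => X v \/ Y v).
Proof.
move=> HX HY; apply: (@Def_ext _ (fun v => ~ X v -> Y v)).
  move=> v; split; last by case.
  by case: (pselect (X v)) => [|nX /(_ nX)]; [left|right].
by apply/Def_imp/HY/Def_not.
Qed.

Lemma Def_true V : Def (fun _ : V -> C => True).
Proof. by apply: (Def_ext _ (Def_not (Def_false V))) => v; split=> // _ []. Qed.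

Lemma Def_eq V (i j : V) : Def (fun v => v i = v j).
Proof.
exists 2, (Feq L ord0 ord_max), (fun k => if k == ord0 then i else j) => v /=.
by rewrite !tnth_mktuple.
Qed.

Lemma Def_rel V (r : L) (i : V) : Def (fun v => interp (nseq_tuple (arity r) (v i))).
Proof.
exists 1%N, (Frel (nseq_tuple (arity r) (ord0 : 'I_1))), (fun=> i) => v /=.
suff -> : map_tuple (tnth [tuple v i | _ < 1]) (nseq_tuple (arity r) ord0) =
    nseq_tuple (arity r) (v i) by [].
by apply: eq_from_tnth => k; rewrite tnth_map !tnth_nseq tnth_mktuple.
Qed.

Lemma Def_all1 V (X : (option V -> C) -> Prop) :
  Def X -> Def (fun v => forall z, X (ocase z v)).
Proof.
(* Variables sent to [None] all become the bound variable. The others are lifted, and [v0] fills the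
   places no longer read; if [V] is empty, every variable is bound. *)
move=> [p [phi [f H]]]; have [[v0 _]|nV] := pselect (exists v : V, True).
  exists p, (Fall (ren phi (fun i => if f i is Some _ then lift ord0 i else ord0))),
    (fun i => if f i is Some j then j else v0) => v /=.
  suff E z : [tuple tnth (cons_tuple z
        [tuple v (if f i0 is Some j then j else v0) | i0 < p])
      (if f i is Some _ then lift ord0 i else ord0) | i < p] =
      [tuple ocase z v (f i) | i < p].
    by split=> K z; move/(_ z): K; rewrite sat_ren E H.
  apply: eq_from_tnth => i; rewrite !tnth_mktuple.
  by case E: (f i) => [j|]; rewrite ?tnth0 //= tnthS tnth_mktuple E.
have g : 'I_0 -> V by case.
exists 0, (Fall (ren phi (fun=> ord0))), g => v /=.
suff E z t : [tuple tnth (cons_tuple z t : 1.-tuple C) ord0 | i < p] =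
    [tuple ocase z v (f i) | i < p].
  by split=> K z; move/(_ z): K; rewrite sat_ren E H.
apply: eq_from_tnth => i; rewrite !tnth_mktuple tnth0.
by case: (f i) => // j; case: nV; exists j.
Qed.

Lemma Def_ex1 V (X : (option V -> C) -> Prop) :
  Def X -> Def (fun v => exists z, X (ocase z v)).
Proof.
move=> HX; apply: (@Def_ext _ (fun v => ~ forall z, ~ X (ocase z v))).
  by move=> v; rewrite -existsNE; under eq_exists do rewrite notK.
exact: (Def_not (Def_all1 (Def_not HX))).
Qed.

(** A formula has finitely many variables, so every definable relation is supported by some [q];
    this bounds the number of quantifiers needed for an infinite tuple. *)
Definition supported V q (X : (nat + V -> C) -> Prop) :=
  forall a a' v, (forall j, (j < q)%N -> a j = a' j) ->
    X (scase a v) -> X (scase a' v).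

Lemma Def_supported V (X : (nat + V -> C) -> Prop) :
  Def X -> exists q, supported q X.
Proof.
move=> [p [phi [f H]]].
exists (\max_(i < p) if f i is inl j then j.+1 else 0)%N => a a' v aa'.
rewrite !H; suff -> : [tuple scase a v (f i) | i < p] =
  [tuple scase a' v (f i) | i < p] by [].
apply: eq_from_tnth => i; rewrite !tnth_mktuple.
case E: (f i) => [j|] //=; apply: aa'.
by have := leq_bigmax (F := fun i => if f i is inl j then j.+1 else 0)%N i;
  rewrite E.
Qed.

Lemma Def_ex_supported V (v0 : V) q (X : (nat + V -> C) -> Prop) :
  Def X -> supported q X -> Def (fun v => exists a, X (scase a v)).
Proof.
elim: q V v0 X => [|q IH] V v0 X HX sX.
  (* No coordinate of [a] is read any more, but some [a] must exist: [v v0] supplies a value, as the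
     carrier may be empty. *)
  apply: (@Def_ext _ (fun v => X (scase (fun=> v v0) v))).
    by move=> v; split=> [|[a]]; [exists (fun=> v v0)|apply: sX].
  apply: (Def_ext _ (Def_ren (scase (fun _ : nat => v0) id) HX)) => v.
  by have -> // : v \o scase (fun _ : nat => v0) id = scase (fun=> v v0) v
    by apply: funext => -[].
pose f (s : nat + V) : nat + option V :=
  match s with
  | inl 0 => inr None
  | inl j.+1 => inl j
  | inr u => inr (Some u)
  end%N.
have fE a z v : scase a (ocase z v) \o f =
    scase (fun j => if j is j'.+1 then a j' else z) v.
  by apply: funext => -[[|j]|u].
have := Def_ex1 (IH _ None _ (Def_ren f HX) _); move=> H.
apply: Def_ext (H _).
  move=> v; split=> [[z [a]]|[a Xa]].
    by rewrite fE => Xa; eexists; exact: Xa.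
  exists (a 0%N), (fun j => a j.+1); rewrite fE.
  by have -> // : (fun j => if j is j'.+1 then a j'.+1 else a 0%N) = a
    by apply: funext => -[].
move=> a a' v aa'; have [z [w ->]] : exists z w, v = ocase z w.
  by exists (v None), (v \o Some); apply: funext => -[].
by rewrite !fE; apply: sX => -[|j] //; rewrite ltnS; apply: aa'.
Qed.

Lemma Def_ex_nat V (v0 : V) (X : (nat + V -> C) -> Prop) :
  Def X -> Def (fun v => exists a, X (scase a v)).
Proof.
by move=> HX; have [q sX] := Def_supported HX; apply: Def_ex_supported sX.
Qed.

End Definability.

Section Curried.
Variables (L : language) (C : structure L).

Definition Def1 V (F : C -> (V -> C) -> Prop) :=
  Def (fun u : option V -> C => F (u None) (u \o Some)).

Definition Def2 U V (F : (U -> C) -> (V -> C) -> Prop) :=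
  Def (fun u : U + V -> C => F (u \o inl) (u \o inr)).

Definition Def12 U V (F : C -> (U -> C) -> (V -> C) -> Prop) :=
  Def (fun u : option (U + V) -> C => F (u None) (u \o Some \o inl) (u \o Some \o inr)).

Definition Def3 U V W (F : (U -> C) -> (V -> C) -> (W -> C) -> Prop) :=
  Def (fun u : U + (V + W) -> C => F (u \o inl) (u \o inr \o inl) (u \o inr \o inr)).

Lemma Def2_app U V W (F : (U -> C) -> (V -> C) -> Prop) (f : U -> W) (g : V -> W) :
  Def2 F -> Def (fun w => F (w \o f) (w \o g)).
Proof. exact: (Def_ren (fun s => match s with inl i => f i | inr j => g j end)). Qed.

Lemma Def12_app U V W (F : C -> (U -> C) -> (V -> C) -> Prop)
    (k : W) (f : U -> W) (g : V -> W) :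
  Def12 F -> Def (fun w => F (w k) (w \o f) (w \o g)).
Proof.
exact: (Def_ren (fun s => match s with
  | None => k | Some (inl i) => f i | Some (inr j) => g j end)).
Qed.

Lemma Def3_app U V W T (F : (U -> C) -> (V -> C) -> (W -> C) -> Prop)
    (f : U -> T) (g : V -> T) (h : W -> T) :
  Def3 F -> Def (fun w => F (w \o f) (w \o g) (w \o h)).
Proof.
exact: (Def_ren (fun s => match s with
  | inl i => f i | inr (inl j) => g j | inr (inr k) => h k end)).
Qed.

Lemma Def_ex V (F : C -> (V -> C) -> Prop) :
  Def1 F -> Def (fun v => exists z, F z v).
Proof. exact: Def_ex1. Qed.

Lemma Def_all V (F : C -> (V -> C) -> Prop) :
  Def1 F -> Def (fun v => forall z, F z v).
Proof. exact: Def_all1. Qed.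

Lemma Def_exs (K : countType) V (v0 : V) (F : (K -> C) -> (V -> C) -> Prop) :
  Def2 F -> Def (fun v => exists x, F x v).
Proof.
move=> HF; pose f (s : K + V) : nat + V :=
  match s with inl k => inl (pickle k) | inr j => inr j end.
apply: Def_ext (Def_ex_nat v0 (Def_ren f HF)) => v; split=> [[a]|[x Xx]].
  by exists (a \o pickle).
exists (fun j => if unpickle j is Some k then x k else v v0).
suff -> : scase (fun j => if unpickle j is Some k then x k else v v0) v \o f
  = scase x v by [].
by apply: funext => -[k|] //=; rewrite pickleK.
Qed.

Lemma Def_alls (K : countType) V (v0 : V) (F : (K -> C) -> (V -> C) -> Prop) :
  Def2 F -> Def (fun v => forall x, F x v).
Proof.
move=> HF; apply: (@Def_ext _ _ _ (fun v => ~ exists x, ~ F x v)) => [v|].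
  split=> [H x|H [x nF]]; last exact: (nF (H x)).
  by apply: contrapT => nF; apply: H; exists x.
exact: (Def_not (Def_exs v0 (Def_not HF))).
Qed.

End Curried.

Section InstancesOver.
Variables (L : language) (C : structure L).
Implicit Type B : set C.

Definition inset V B (v : V -> C) := forall j, B (v j).

Definition two B := exists p q, [/\ B p, B q & p <> q].

(** The rank admits one [rho] and one [D]; finitely many relations are traded for a single one
    covering each of them, at the cost of more parameters from [B]. *)
Definition covers K V B (Z : (K -> C) -> (nat -> C) -> Prop)
    (Y : (K -> C) -> (V -> C) -> Prop) :=
  forall v, inset B v -> exists2 e, inset B e & forall x, Z x e <-> Y x v.

Fixpoint conj_all T (Q : T -> Prop) (s : seq T) : Prop :=
  if s is y :: s' then Q y /\ conj_all Q s' else True.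

Lemma inset_scase U V B (v : U -> C) (w : V -> C) :
  inset B v -> inset B w -> inset B (scase v w).
Proof. by move=> hv hw []. Qed.

Lemma inset_ocase V B z (v : V -> C) : B z -> inset B v -> inset B (ocase z v).
Proof. by move=> hz hv []. Qed.

Lemma cover_count K (V : countType) (v0 : V) (Y : (K -> C) -> (V -> C) -> Prop) :
  Def2 Y -> exists2 Z : (K -> C) -> (nat -> C) -> Prop, Def2 Z & forall B, covers B Z Y.
Proof.
move=> HY; exists (fun x e => Y x (e \o pickle)); first exact: (Def2_app _ _ HY).
move=> B v Bv; exists (fun j => v (odflt v0 (unpickle j))); first by move=> j; apply: Bv.
move=> x; suff -> : (fun j => v (odflt v0 (unpickle j))) \o pickle = v by [].
by apply: funext => j /=; rewrite pickleK.
Qed.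

(* The first two parameters tell which of the two relations is meant. *)
Lemma cover_two K (X Y : (K -> C) -> (nat -> C) -> Prop) : Def2 X -> Def2 Y ->
  exists2 Z : (K -> C) -> (nat -> C) -> Prop, Def2 Z &
    forall B, two B -> covers B Z X /\ covers B Z Y.
Proof.
move=> HX HY; pose s2 j := j.+2.
exists (fun x e => (e 0 = e 1 /\ X x (e \o s2)) \/ (e 0 <> e 1 /\ Y x (e \o s2)))%N.
  apply: Def_or; apply: Def_and; try exact: (Def2_app _ _ HX);
    try exact: (Def2_app _ _ HY).
    exact: (@Def_eq _ _ (K + nat) (inr 0%N) (inr 1%N)).
  exact: (Def_not (@Def_eq _ _ (K + nat) (inr 0%N) (inr 1%N))).
move=> B [p [q [Bp Bq pq]]].
pose w r (e : nat -> C) k := if k is k'.+1 then if k' is k''.+1 then e k'' else r else p.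
have Bw r e : B r -> inset B e -> inset B (w r e).
  by move=> Br Be [|[|k]] //; apply: Be.
split=> e Be; [exists (w p e)|exists (w q e)] => [|x||x]; try exact: Bw.
  by split=> [[[]|[]]|] //; left.
by split=> [[[]|[]]|] //; right.
Qed.

Lemma cover_all K (V : countType) (v0 : V) (s : seq ((K -> C) -> (V -> C) -> Prop)) :
  conj_all (@Def2 _ _ _ _) s ->
  exists2 Z : (K -> C) -> (nat -> C) -> Prop, Def2 Z &
    forall B, two B -> conj_all (covers B Z) s.
Proof.
elim: s => [|Y s IH] /=; first by exists (fun _ _ => True); [exact: Def_true|].
move=> [/(cover_count v0)[Y' HY' cY] /IH[Z' HZ' cZ]].
have [Z HZ cYZ] := cover_two HY' HZ'; exists Z => // B tB.
have [ZY' ZZ'] := cYZ B tB; split.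
  move=> v /cY[e /ZY'[e' Be' E'] E]; exists e' => // x.
  by rewrite E' E.
move: (cZ B tB) => {}cZ; elim: s {IH} cZ => //= X s IH [Z'X /IH ?]; split=> //.
move=> v /Z'X[e /ZZ'[e' Be' E'] E]; exists e' => // x.
by rewrite E' E.
Qed.

Definition DefB (K : Type) B (theta : (K -> C) -> Prop) :=
  exists (X : (K -> C) -> (nat -> C) -> Prop) e,
    [/\ Def2 X, inset B e & forall x, theta x <-> X x e].

Lemma DefB_intro K (V : countType) (v0 : V) B (Y : (K -> C) -> (V -> C) -> Prop) v :
  Def2 Y -> inset B v -> DefB B (Y^~ v).
Proof.
move=> /(cover_count v0)[Z HZ /(_ B v) cZ] /cZ[e Be E].
by exists Z, e; split=> // x; rewrite E.
Qed.

Lemma DefB_and K B (X Y : (K -> C) -> Prop) :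
  DefB B X -> DefB B Y -> DefB B (fun x => X x /\ Y x).
Proof.
move=> [X' [e [HX' Be XE]]] [Y' [d [HY' Bd YE]]].
have [Z [h [HZ Bh ZE]]] := @DefB_intro _ _ (inl 0%N) B
  (fun x w => X' x (w \o inl) /\ Y' x (w \o inr)) _
  (Def_and (Def2_app _ _ HX') (Def2_app _ _ HY')) (inset_scase Be Bd).
by exists Z, h; split=> // x; rewrite -ZE XE YE.
Qed.

Lemma DefB_not K B (X : (K -> C) -> Prop) : DefB B X -> DefB B (fun x => ~ X x).
Proof.
move=> [X' [e [HX' Be XE]]]; exists (fun x w => ~ X' x w), e.
by split=> // [|x]; [exact: Def_not|rewrite XE].
Qed.

End InstancesOver.

(** * The local rank *)

Section Rank.
Variables (L : language) (C : structure L) (P : L).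
Implicit Type B : set C.
Notation P_ := (@Pset L C P).

Lemma Def_P V (i : V) : Def (fun v => P_ (v i)).
Proof. exact: Def_rel. Qed.

Section Fixed.
Variables (K : countType) (B : set C).
Variables (rho : (K -> C) -> (nat -> C) -> Prop)
  (D : C -> (K -> C) -> (nat -> C) -> Prop).

(* Each step asks for a splitting by an instance of rho, and for a decision on
   every instance of "some z in P satisfies D(z, x, b)", with z found in B when
   the instance is accepted. *)
Fixpoint rank r (theta : (K -> C) -> Prop) : Prop :=
  if r is r'.+1 then
    (exists2 a, inset B a &
      rank r' (fun x => theta x /\ rho x a) /\
      rank r' (fun x => theta x /\ ~ rho x a)) /\
    (forall b, inset B b ->
      rank r' (fun x => theta x /\ ~ exists z, P_ z /\ D z x b) \/
      exists z, [/\ P_ z, B z & rank r' (fun x => theta x /\ D z x b)])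
  else exists x, theta x.

Lemma rank_mono r (X Y : (K -> C) -> Prop) :
  (forall x, X x -> Y x) -> rank r X -> rank r Y.
Proof.
elim: r X Y => [|r IH] X Y XY /=; first by move=> [x /XY]; exists x.
move=> [[a Ba [H1 H2]] H]; split.
  by exists a => //; split; [apply: IH H1|apply: IH H2] => x [/XY].
move=> b /H[Hb|[z [Pz Bz Hz]]]; [left; apply: IH Hb|right; exists z; split=> //;
  apply: IH Hz] => x [/XY] //.
Qed.

End Fixed.

Definition decides K V B (Y : (K -> C) -> (V -> C) -> Prop) (theta : (K -> C) -> Prop) :=
  forall v, inset B v ->
  (forall x, theta x -> Y x v) \/ (forall x, theta x -> ~ Y x v).

Lemma decides_cover K V B Z (Y : (K -> C) -> (V -> C) -> Prop) theta :
  covers B Z Y -> decides B Z theta -> decides B Y theta.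
Proof.
move=> ZY dec v /ZY[e /dec[] H E]; [left|right] => x /H; by rewrite E.
Qed.

(** Over [B], each demand of [D] is also one of [D'], so the rank for [D'] has more demands to
    meet. *)
Lemma rank_cover (K : countType) B rho (D D' : C -> (K -> C) -> (nat -> C) -> Prop) r X :
  covers B (fun (x : option K -> C) => D' (x None) (x \o Some))
           (fun (x : option K -> C) => D (x None) (x \o Some)) ->
  rank B rho D' r X -> rank B rho D r X.
Proof.
move=> DD'; elim: r X => [|r IH] X //= [[a Ba [H1 H2]] H]; split.
  by exists a => //; split; apply: IH.
move=> b /DD'[b' /H Hb' E].
have {}E z x : D' z x b' <-> D z x b by exact: (E (ocase z x)).
case: Hb' => [Hb|[z [Pz Bz Hz]]]; [left|right].
  apply/IH/rank_mono/Hb => x [Xx nx]; split=> // -[z [Pz dz]].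
  by apply: nx; exists z; rewrite E.
exists z; split=> //; apply/IH/rank_mono/Hz => x [Xx]; split=> //.
by rewrite -E.
Qed.

(** Over [setT] the parameters and witnesses in the rank are arbitrary elements of [C], so its
    clauses are first-order quantifiers; a proper subset [B] need not be definable. *)
Lemma Def_rank (K : countType) V (v0 : V) rho (D : C -> (K -> C) -> (nat -> C) -> Prop)
    r (G : (K -> C) -> (V -> C) -> Prop) :
  Def2 rho -> Def12 D -> Def2 G ->
  Def (fun v : V -> C => rank setT rho D r (G^~ v)).
Proof.
move=> Hrho HD; elim: r V v0 G => [|r IH] V v0 G HG /=.
  exact: Def_exs.
apply: Def_and.
  apply: (Def_ext _ (Def_exs (K := nat) (F := fun a v =>
    rank setT rho D r (fun x => G x v /\ rho x a) /\
    rank setT rho D r (fun x => G x v /\ ~ rho x a)) v0 _)).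
    by move=> v; split=> [[a ?]|[a _ ?]]; exists a.
  apply: Def_and; apply: (IH _ (inr v0) (fun x w => G x (w \o inr) /\ _)).
    exact: (Def_and (Def2_app _ _ HG) (Def2_app _ _ Hrho)).
  exact: (Def_and (Def2_app _ _ HG) (Def_not (Def2_app _ _ Hrho))).
apply: (Def_ext _ (Def_alls (K := nat) (F := fun b v =>
    rank setT rho D r (fun x => G x v /\ ~ exists z, P_ z /\ D z x b) \/
    exists z, P_ z /\ rank setT rho D r (fun x => G x v /\ D z x b)) v0 _)).
  move=> v; split=> H b => [_|]; (case: (H b) => //; first by left).
    by move=> [z [Pz Hz]]; right; exists z.
  by move=> [z [Pz _ Hz]]; right; exists z.
apply: Def_or.
  apply: (IH _ (inr v0) (fun x w => G x (w \o inr) /\ _)).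
  apply: Def_and; first exact: (Def2_app _ _ HG).
  apply/Def_not/(Def_ex (F := fun z u => P_ z /\ D z (u \o inl) (u \o inr \o inl))).
  exact: (Def_and (Def_P None) (Def12_app None _ _ HD)).
apply: (Def_ex (F := fun z u => P_ z /\
  rank setT rho D r (fun x => G x (u \o inr) /\ D z x (u \o inl)))).
apply: Def_and; first exact: (Def_P None).
apply: (IH _ None (fun x w => G x (w \o Some \o inr) /\ D (w None) x (w \o Some \o inl))).
exact: (Def_and (Def2_app _ _ HG) (Def12_app (inr None) _ _ HD)).
Qed.

(* When S contains B: S is complete and meets P only in B. *)
Definition witnessing B (S : set C) := forall (V : Type) (F : C -> (V -> C) -> Prop) v,
  Def1 F -> inset S v -> (exists z, P_ z /\ F z v) ->
  exists z, [/\ P_ z, B z & F z v].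

(* Unless theta decides rho, it has a part of smaller rank, cut out by an instance of
   rho, of its negation, or by a demand. An accepted demand has a witness z in B
   because B is complete. *)
Lemma decider (K : countType) rho (D : C -> (K -> C) -> (nat -> C) -> Prop) n :
  Def2 rho -> Def12 D ->
  exists2 sigma : (K -> C) -> (nat -> C) -> Prop, Def2 sigma &
    forall B, two B -> witnessing B B ->
    forall theta, DefB B theta -> (exists x, theta x) -> ~ rank B rho D n theta ->
    exists e, [/\ inset B e, exists x, theta x /\ sigma x e &
      decides B rho (fun x => theta x /\ sigma x e)].
Proof.
move=> Hrho HD; elim: n => [|n [sigma Hs IH]].
  by exists (fun _ _ => True); [exact: Def_true|].
pose V := ((option nat) + nat)%type.
have Hs' : Def2 (fun x (u : V -> C) => sigma x (u \o inr)).
  exact: (Def2_app _ _ Hs).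
have Hr' : Def2 (fun x (u : V -> C) => rho x (u \o inl \o Some)).
  exact: (Def2_app _ _ Hrho).
have HYm : Def2 (fun (x : K -> C) (u : V -> C) =>
    ~ exists z, P_ z /\ D z x (u \o inl \o Some)).
  apply/Def_not/(Def_ex (F := fun z u => P_ z /\ D z _ _)).
  exact: (Def_and (Def_P None) (Def12_app None _ _ HD)).
have HYz : Def2 (fun (x : K -> C) (u : V -> C) => D (u (inl None)) x (u \o inl \o Some)).
  exact: (Def12_app (inr (inl None)) _ _ HD).
have [tau Htau ctau] := @cover_all _ C K V (inr 0%N) [:: fun _ _ => True;
    fun x u => rho x (u \o inl \o Some) /\ sigma x (u \o inr);
    fun x u => ~ rho x (u \o inl \o Some) /\ sigma x (u \o inr);
    fun x u => (~ exists z, P_ z /\ D z x (u \o inl \o Some)) /\ sigma x (u \o inr);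
    fun x u => D (u (inl None)) x (u \o inl \o Some) /\ sigma x (u \o inr)]
  (conj (Def_true _ _) (conj (Def_and Hr' Hs') (conj (Def_and (Def_not Hr') Hs')
  (conj (Def_and HYm Hs') (conj (Def_and HYz Hs') I))))).
exists tau => // B tB wB theta dtheta [x0 tx0] nrk.
have [c0 [c1 [c2 [c3 [c4 _]]]]] := ctau B tB.
have [p [q [Bp _ _]]] := tB.
(* The inductive step: a consistent part [theta /\ X] of smaller rank contains an isolating formula
   from [sigma], and an instance of [tau] expresses [X] together with that formula. *)
have reduce (X : (K -> C) -> Prop) Y (v : option nat -> C) : covers B tau Y ->
    inset B v -> DefB B X -> (exists x, theta x /\ X x) ->
    ~ rank B rho D n (fun x => theta x /\ X x) ->
    (forall x e, Y x (scase v e) <-> X x /\ sigma x e) ->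
    exists e, [/\ inset B e, exists x, theta x /\ tau x e &
      decides B rho (fun x => theta x /\ tau x e)].
  move=> cY Bv dX neX nX YE.
  have [e [Be [x [[tx Xx] sx]] dec]] := IH B tB wB _ (DefB_and dtheta dX) neX nX.
  have [e' Be' E] := cY _ (inset_scase Bv Be).
  have E' y : tau y e' <-> X y /\ sigma y e by rewrite E YE.
  exists e'; split=> //; first by exists x; rewrite E'.
  by move=> a' /dec[H|H]; [left|right] => y [ty /E'[Xy sy]]; apply: H.
have [ndec|/contrapT dec] := pselect (~ decides B rho theta); last first.
  have [e Be E] := c0 (fun=> p) (fun=> Bp).
  exists e; split=> //; first by exists x0; rewrite E.
  by move=> a /dec[H|H]; [left|right] => y [ty _]; apply: H.
have [a [Ba [exn exp]]] : exists a, inset B a /\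
    (exists x, theta x /\ ~ rho x a) /\ (exists x, theta x /\ rho x a).
  apply: contrapT => na; apply: ndec => a Ba.
  have [H|H] := pselect (exists x, theta x /\ ~ rho x a); last first.
    by left=> x tx; apply: contrapT => nr; apply: H; exists x.
  by right=> x tx rx; apply: na; exists a; do 2!split=> //; exists x.
have rhoB b : inset B b -> DefB B (rho^~ b) by move=> Bb; exists rho, b.
have [nrp|/contrapT rp] := pselect (~ rank B rho D n (fun x => theta x /\ rho x a)).
  exact: (reduce _ _ (ocase p a) c1 (inset_ocase Bp Ba) (rhoB a Ba) exp nrp).
have [nrn|/contrapT rn] := pselect (~ rank B rho D n (fun x => theta x /\ ~ rho x a)).
  exact: (reduce _ _ (ocase p a) c2 (inset_ocase Bp Ba) (DefB_not (rhoB a Ba)) exn nrn).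
(* Both halves of the splitting by [a] have rank at least [n], so only a demand can keep [theta]
   from rank [n.+1]. *)
have [b [Bb nb]] : exists b, inset B b /\
    ~ (rank B rho D n (fun x => theta x /\ ~ exists z, P_ z /\ D z x b) \/
      exists z, [/\ P_ z, B z & rank B rho D n (fun x => theta x /\ D z x b)]).
  apply: contrapT => nb; apply: nrk; split; first by exists a.
  by move=> b Bb; apply: contrapT => H; apply: nb; exists b.
have [nz|nz] := pselect (exists x, theta x /\ ~ exists z, P_ z /\ D z x b).
  apply: (reduce _ _ (ocase p b) c3 (inset_ocase Bp Bb) _ nz) => //.
  - exists (fun x b => ~ exists z, P_ z /\ D z x b), b; split=> //.
    apply/Def_not/(Def_ex (F := fun z u => P_ z /\ D z _ _)).
    exact: (Def_and (Def_P None) (Def12_app None _ _ HD)).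
  - by move=> rk; apply: nb; left.
have [X [d [HX Bd XE]]] := dtheta.
(* Consistency of [D z] with [theta] is part of the relation to be witnessed, so it survives the
   move of [z] into [B]. *)
have [z [Pz Bz [x [Xx Dx]]]] : exists z, [/\ P_ z, B z &
    exists x, X x d /\ D z x b].
  apply: (wB (nat + nat)%type (fun z w => exists x, X x (w \o inl) /\ D z x (w \o inr))
    (scase d b)).
  - apply: (Def_exs None (F := fun x w => X x _ /\ D (w None) x _)).
    exact: (Def_and (Def2_app _ _ HX) (Def12_app (inr None) _ _ HD)).
  - exact: inset_scase.
  - have [z [Pz dz]] : exists z, P_ z /\ D z x0 b.
      by apply: contrapT => n0; apply: nz; exists x0.
    by exists z; split=> //; exists x0; rewrite /= -XE.
have HD' : Def2 (fun (x : K -> C) u => D (u None) x (u \o Some)).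
  exact: (Def12_app (inr None) _ _ HD).
have := @DefB_intro _ _ K (option nat) None B _ _ HD' (inset_ocase Bz Bb).
move=> /(reduce _ _ _ c4 (inset_ocase Bz Bb)); apply => //.
- by exists x; rewrite XE.
- by move=> rk; apply: nb; right; exists z.
Qed.

End Rank.

(** * Defining types from finite rank *)

Section Reduction.
Variables (L : language) (C : structure L) (P : L).
Notation P_ := (@Pset L C P).
Variables (X : finType) (psi : (X -> C) -> (nat -> C) -> Prop).
Variable (D : C -> (X -> C) -> (nat -> C) -> Prop).
Hypotheses (Hpsi : Def2 psi) (HD : Def12 D).
Variable BB : set (set C).
Hypothesis BB_two : forall B, BB B -> two B.
Hypothesis BB_rank : forall (K : finType) (rho : (K -> C) -> (nat -> C) -> Prop),
  Def2 rho -> exists n (E : C -> (K -> C) -> (nat -> C) -> Prop),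
    Def12 E /\ forall B, BB B -> ~ rank P B rho E n (fun=> True).

Lemma BB_decider (K : finType) (rho : (K -> C) -> (nat -> C) -> Prop) :
  Def2 rho ->
  exists2 sigma : (K -> C) -> (nat -> C) -> Prop, Def2 sigma &
    forall B, BB B -> witnessing P B B ->
    forall theta, DefB B theta -> (exists x, theta x) ->
    exists e, [/\ inset B e, exists x, theta x /\ sigma x e &
      decides B rho (fun x => theta x /\ sigma x e)].
Proof.
move=> Hrho; have [n [E [HE nE]]] := BB_rank Hrho.
have [sigma Hs H] := decider P n Hrho HE; exists sigma => // B hB wB theta dt et.
apply: H => //; first exact: BB_two.
by move=> /(rank_mono (Y := fun=> True)) H; exact: (nE B hB (H _)).
Qed.

(** Makes the parameters of a demand a finite tuple, which can be appended to a tuple indexed by a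
    [finType]. *)
Lemma Def12_supported : exists q, forall b b', (forall j, (j < q)%N -> b j = b' j) ->
  (fun z x => D z x b) = (fun z x => D z x b').
Proof.
have H : Def (fun u : nat + option X -> C => D (u (inr None)) (u \o inr \o Some) (u \o inl)).
  exact: (Def12_app (inr None) _ _ HD).
have [q sq] := Def_supported H; exists q => b b' bb'.
apply: funext => z; apply: funext => x; apply: propext; split.
  exact: (sq b b' (ocase z x) bb').
by apply: (sq b' b (ocase z x)) => j /bb'.
Qed.

(** The set [G(., y, e)] has bounded rank and contains [c] for some [y], but [y] may lie outside [B]
    and is known only through [delta(y, e)], which isolates its [rho]-type over [B]. The order of
    quantifiers matters: [rho] is chosen before [delta], and [Psi] before [B] and [c]. *)
Definition reducible r (K : finType) (V : countType)
    (G : (X -> C) -> (K -> C) -> (V -> C) -> Prop) :=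
  exists2 rho : (K -> C) -> (nat -> C) -> Prop, Def2 rho &
  forall delta : (K -> C) -> (V -> C) -> Prop, Def2 delta ->
  exists2 Psi : (nat -> C) -> (nat -> C) -> Prop, Def2 Psi &
  forall B c e, BB B -> witnessing P B B -> witnessing P B (B `|` range c) ->
    inset B e -> decides B rho (delta^~ e) ->
    (exists y, delta y e /\ G c y e) ->
    (forall y, delta y e -> ~ rank P setT psi D r (fun x => G x y e)) ->
    exists2 d, inset B d & forall a, inset B a -> (psi c a <-> Psi a d).

(* Let y satisfy delta and let gamma = G(., y, e) contain c. If some demand of D
   lowers the rank of gamma, its parameters are added to y, within an isolated
   formula given by BB_decider; a witness z in P can be found in B since B together
   with c is complete. Otherwise gamma has no splitting, and psi(c, a) holds iff
   gamma /\ psi(., a) has the same rank as gamma, unless this fails for the true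
   instance of psi, whose rank is then smaller. *)
Lemma reduction r (K : finType) (V : countType) (v0 : V)
    (G : (X -> C) -> (K -> C) -> (V -> C) -> Prop) :
  Def3 G -> reducible r G.
Proof.
elim: r K V v0 G => [|r IH] K V v0 G HG.
  exists (fun _ _ => True) => [|delta _]; first exact: Def_true.
  exists (fun _ _ => True) => [|B c e _ _ _ _ _ [y [dy Gc]] /(_ y dy) []].
    exact: Def_true.
  by exists c.
have [q Dq] := Def12_supported.
(* [K'] appends the [q] relevant parameters of a demand to [y]; [V'] holds a witness [z] at [None],
   the old parameters, and those of an instance of [sigma]. *)
pose K' : finType := (K + 'I_q)%type.
pose V' : countType := (option V + nat)%type.
(* Beyond the first [q] places any filler [z] will do, by [Dq]. *)
pose clip (y : K' -> C) (z : C) (j : nat) : C :=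
  if insub j is Some i then y (inr i) else z.
(* A demand lowers the rank if neither refusing it nor accepting it with a witness in [P] keeps rank
   [r]. *)
pose badE E y e := ~ rank P setT psi D r (fun x => G x y e /\ ~ exists z, P_ z /\ E z x) /\
  forall z, P_ z -> ~ rank P setT psi D r (fun x => G x y e /\ E z x).
pose bad b := badE (fun z x => D z x b).
have Hbad : Def3 bad.
  apply: Def_and.
    apply: Def_not; apply: (Def_rank P (G := fun x u => G x (u \o inr \o inl) (u \o inr \o inr) /\
      ~ exists z, P_ z /\ D z x (u \o inl)) (inl 0%N) r Hpsi HD).
    apply: Def_and; first exact: (Def3_app _ _ _ HG).
    apply: Def_not; apply: (Def_ex (F := fun z u => P_ z /\ D z (u \o inl) (u \o inr \o inl))).
    exact: (Def_and (Def_P C P None) (Def12_app None _ _ HD)).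
  apply: (Def_all (F := fun z u => P_ z -> ~ _)).
  apply: Def_imp; first exact: (Def_P C P None).
  apply: Def_not; apply: (Def_rank P (G := fun x u => G x (u \o Some \o inr \o inl)
    (u \o Some \o inr \o inr) /\ D (u None) x (u \o Some \o inl)) None r Hpsi HD).
  exact: (Def_and (Def3_app _ _ _ HG) (Def12_app (inr None) _ _ HD)).
pose bad' (y : K' -> C) (e : V -> C) := bad (clip y (e v0)) (y \o inl) e.
have clipE T (f : K' -> T) (k : T) (u : T -> C) :
    clip (u \o f) (u k) = u \o (fun j => if insub j is Some i then f (inr i) else k).
  by apply: funext => j; rewrite /clip /=; case: insub.
have Hbad' : Def2 bad'.
  apply: Def_ext (Def3_app (fun j => if insub j is Some i then inl (inr i) else inr v0)
    (inl \o inl) inr Hbad) => u.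
  by rewrite /bad' (clipE _ inl (inr v0)).
pose G1 x (y : K' -> C) (w : V' -> C) := G x (y \o inl) (w \o inl \o Some) /\
  D (w (inl None)) x (clip y (w (inl (Some v0)))).
pose G2 x (y : K' -> C) (w : V' -> C) := G x (y \o inl) (w \o inl \o Some) /\
  ~ exists z, P_ z /\ D z x (clip y (w (inl (Some v0)))).
have HG1 : Def3 G1.
  apply: Def_and; first exact: (Def3_app _ _ _ HG).
  apply: Def_ext (Def12_app (inr (inr (inl None))) inl (fun j => if insub j is Some i
    then inr (inl (inr i)) else inr (inr (inl (Some v0)))) HD) => u.
  by rewrite (clipE _ (inr \o inl) (inr (inr (inl (Some v0))))).
have HG2 : Def3 G2.
  apply: Def_and; first exact: (Def3_app _ _ _ HG).
  apply: Def_not; apply: (Def_ex (F := fun z u => P_ z /\ D z (u \o inl)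
    (clip (u \o inr \o inl) (u (inr (inr (inl (Some v0)))))))).
  apply: Def_and; first exact: (Def_P C P None).
  apply: Def_ext (Def12_app None (Some \o inl) (fun j => if insub j is Some i
    then Some (inr (inl (inr i))) else Some (inr (inr (inl (Some v0))))) HD) => u.
  by rewrite (clipE _ (Some \o inr \o inl) (Some (inr (inr (inl (Some v0)))))).
have [rho1 Hrho1 IH1] := IH K' V' (inr 0%N) G1 HG1.
have [rho2 Hrho2 IH2] := IH K' V' (inr 0%N) G2 HG2.
have [rho' Hrho' crho'] := cover_all 0%N (s := [:: rho1; rho2])
  (conj Hrho1 (conj Hrho2 I)).
have [sigma Hsigma Bsigma] := BB_decider Hrho'.
(* What [rho] must decide includes whether some demand lowers the rank ([R1]), whether [y] extends
   into the isolated formula ([R2]), and whether rank [r] survives adding [psi] ([R3]) or its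
   negation ([R4]). *)
pose R1 y e := exists b, bad b y e.
have HR1 : Def2 R1.
  apply: (Def_exs (F := fun b u => bad b (u \o inl) (u \o inr)) (inr v0)).
  exact: (Def3_app _ _ _ Hbad).
pose R2 y (u : V + nat -> C) :=
  exists b, bad' (scase y b) (u \o inl) /\ sigma (scase y b) (u \o inr).
have HR2 : Def2 R2.
  apply: (Def_exs (F := fun b u => bad' (scase (u \o inl) b) (u \o inr \o inl) /\
    sigma (scase (u \o inl) b) (u \o inr \o inr)) (inr (inr 0%N))).
  pose f (s : K') : 'I_q + (K + (V + nat)) :=
    match s with inl k => inr (inl k) | inr i => inl i end.
  have fE (u : 'I_q + (K + (V + nat)) -> C) :
      scase (u \o inr \o inl) (u \o inl) = u \o f by apply: funext => -[].
  by apply: Def_and; [apply: Def_ext (Def2_app f (inr \o inr \o inl) Hbad')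
    |apply: Def_ext (Def2_app f (inr \o inr \o inr) Hsigma)] => u; rewrite -fE.
pose G3 x y (u : V + nat -> C) := G x y (u \o inl) /\ psi x (u \o inr).
pose G4 x y (u : V + nat -> C) := G x y (u \o inl) /\ ~ psi x (u \o inr).
have HG3 : Def3 G3.
  exact: (Def_and (Def3_app _ _ _ HG) (Def2_app _ _ Hpsi)).
have HG4 : Def3 G4.
  exact: (Def_and (Def3_app _ _ _ HG) (Def_not (Def2_app _ _ Hpsi))).
have [rho3 Hrho3 IH3] := IH K (V + nat)%type (inr 0%N) G3 HG3.
have [rho4 Hrho4 IH4] := IH K (V + nat)%type (inr 0%N) G4 HG4.
pose R3 y u := rank P setT psi D r (fun x => G3 x y u).
pose R4 y u := rank P setT psi D r (fun x => G4 x y u).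
have HR3 : Def2 R3.
  exact: (Def_rank P (G := fun x u => G3 x (u \o inl) (u \o inr)) (inr (inr 0%N)) r Hpsi HD).
have HR4 : Def2 R4.
  exact: (Def_rank P (G := fun x u => G4 x (u \o inl) (u \o inr)) (inr (inr 0%N)) r Hpsi HD).
have [rho Hrho crho] := @cover_all _ C K (V + nat)%type (inr 0%N)
  [:: fun y u => R1 y (u \o inl); R2; R3; R4;
      fun y u => rho3 y (u \o inr); fun y u => rho4 y (u \o inr)]
  (conj (Def2_app _ _ HR1) (conj HR2 (conj HR3 (conj HR4
    (conj (Def2_app _ _ Hrho3) (conj (Def2_app _ _ Hrho4) I)))))).
exists rho => // delta Hdelta.
pose delta' (y : K' -> C) (w : V' -> C) :=
  (delta (y \o inl) (w \o inl \o Some) /\ bad' y (w \o inl \o Some)) /\ sigma y (w \o inr).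
have Hdelta' : Def2 delta'.
  exact: (Def_and (Def_and (Def2_app _ _ Hdelta) (Def2_app _ _ Hbad'))
    (Def2_app _ _ Hsigma)).
have [Psi1 HPsi1 {}IH1] := IH1 delta' Hdelta'.
have [Psi2 HPsi2 {}IH2] := IH2 delta' Hdelta'.
have Hdelta0 : Def2 (fun y (u : V + nat -> C) => delta y (u \o inl)).
  exact: (Def2_app _ _ Hdelta).
have [Psi3 HPsi3 {}IH3] := IH3 _ Hdelta0.
have [Psi4 HPsi4 {}IH4] := IH4 _ Hdelta0.
have HPsi0 : Def2 (fun a e => exists y, delta y e /\ R3 y (scase e a)).
  apply: (Def_exs (F := fun y u => delta y (u \o inr) /\
    R3 y (scase (u \o inr) (u \o inl))) (inl 0%N)).
  pose f (s : V + nat) : K + (nat + V) :=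
    match s with inl k => inr (inr k) | inr i => inr (inl i) end.
  apply: (Def_and (Def2_app _ _ Hdelta)); apply: Def_ext (Def2_app inl f HR3) => u.
  by have -> : scase (u \o inr \o inr) (u \o inr \o inl) = u \o f
    by apply: funext => -[].
have [Psi0 {}HPsi0 cPsi0] := cover_count v0 HPsi0.
have [Psi HPsi cPsi] := cover_all 0%N (s := [:: Psi0; Psi1; Psi2; Psi3; Psi4])
  (conj HPsi0 (conj HPsi1 (conj HPsi2 (conj HPsi3 (conj HPsi4 I))))).
exists Psi => // B c e hB wB wc Be dec [y0 [dy0 Gy0]] nrk.
have tB := BB_two hB.
have [cR1 [cR2 [cR3 [cR4 [cR5 [cR6 _]]]]]] := crho B tB.
have [c1 [c2 _]] := crho' B tB.
have [p0 [p1 [p2 [p3 [p4 _]]]]] := cPsi B tB.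
have finish (Psi' : (nat -> C) -> (nat -> C) -> Prop) : covers B Psi Psi' ->
    (exists2 d, inset B d & forall a, inset B a -> (psi c a <-> Psi' a d)) ->
    exists2 d, inset B d & forall a, inset B a -> (psi c a <-> Psi a d).
  move=> cP [d /cP[d' Bd' E] H]; exists d' => // a Ba.
  by rewrite E; apply: H.
have [p [_ [Bp _ _]]] := tB.
have Bp' : inset B (fun _ : nat => p) by [].
case: (decides_cover cR1 dec (inset_scase Be Bp')) => isbad.
- pose theta (y : K' -> C) := delta (y \o inl) e /\ bad' y e.
  have dtheta : DefB B theta.
    apply: (@DefB_intro _ _ K' V v0 B (fun y e => delta (y \o inl) e /\ bad' y e) e) => //.
    exact: (Def_and (Def2_app _ _ Hdelta) Hbad').
  (* An instance of [sigma] isolates a [rho']-type of tuples with a rank-lowering demand attached;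
     the first block of its realization [y1] need not be [y0]. *)
  have [|e' [Be' [y1 [[dy1 by1] sy1]] dec']] := Bsigma B hB wB theta dtheta.
    have [b hb] := isbad _ dy0; exists (scase y0 (b \o val)); split=> //.
    rewrite /bad' /bad; suff <- : (fun z x => D z x b) =
      (fun z x => D z x (clip (scase y0 (b \o val)) (e v0))) by [].
    by apply: Dq => j jq; rewrite /clip insubT.
  pose w z : V' -> C := scase (ocase z e) e'.
  have Bw z : B z -> inset B (w z).
    by move=> Bz; exact: (inset_scase (inset_ocase Bz Be) Be').
  (* [R2] is decided on [delta] and holds at the first block of [y1], hence at every [y] in [delta],
     in particular at [y0]. *)
  have ext y : delta y e -> exists b, bad' (scase y b) e /\ sigma (scase y b) e'.
    move=> dy; case: (decides_cover cR2 dec (inset_scase Be Be')) => H.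
      exact: H.
    case: (H _ dy1); exists (y1 \o inr).
    by have -> : scase (y1 \o inl) (y1 \o inr) = y1 by apply: funext => -[].
  have [b0 [bb0 sb0]] := ext y0 dy0.
  have [[z [Pz [y hy]]]|nz] := pselect (exists z, P_ z /\ exists y,
      delta' y (w z) /\ G1 c y (w z)).
    (* The witness enters [G1] as a parameter, so it must lie in [B]; the tuple [y] may change with
       it. *)
    have [z' [Pz' Bz' hz']] : exists z, [/\ P_ z, B z & exists y,
        delta' y (w z) /\ G1 c y (w z)].
      apply: (wc _ (fun z u => exists y, ((delta (y \o inl) (u \o inr \o inl) /\
        bad' y (u \o inr \o inl)) /\ sigma y (u \o inr \o inr)) /\
        G (u \o inl) (y \o inl) (u \o inr \o inl) /\
        D z (u \o inl) (clip y (u (inr (inl v0))))) (scase c (scase e e'))).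
      - apply: (Def_exs (F := fun y u => ((delta _ _ /\ bad' _ _) /\ sigma _ _) /\
          G _ _ _ /\ D (u None) _ (clip y (u (Some (inr (inl v0)))))) None).
        apply: Def_and (Def_and (Def3_app _ _ _ HG) _).
          exact: (Def_and (Def_and (Def2_app _ _ Hdelta) (Def2_app _ _ Hbad'))
            (Def2_app _ _ Hsigma)).
        apply: Def_ext (Def12_app (inr None) (inr \o Some \o inl) (fun j =>
          if insub j is Some i then inl (inr i) else inr (Some (inr (inl v0)))) HD) => u.
        by rewrite (clipE _ inl (inr (Some (inr (inl v0))))).
      - by apply: inset_scase => [j|j]; [right; exists j|left; exact: inset_scase].
      - by exists z; split=> //; exists y.
    apply: (finish Psi1) => //; apply: (IH1 B c (w z')) => //.
    + exact: Bw.
    + exact: (decides_cover c1 dec').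
    + by move=> y' [[_ [_ bady']] _]; exact: bady'.
  apply: (finish Psi2) => //; apply: (IH2 B c (w p)) => //.
  + exact: Bw.
  + exact: (decides_cover c2 dec').
  + exists (scase y0 b0); split; first by split; first split.
    split=> // -[z [Pz Dz]].
    by apply: nz; exists z; split=> //; exists (scase y0 b0).
  + by move=> y' [[_ [bady' _]] _]; exact: bady'.
(* If a true instance of [psi] lowers the rank, the smaller set [G3] still contains [c]; likewise
   below for a false instance and [G4]. *)
have [[a [Ba pa ra]]|n3] := pselect (exists a, [/\ inset B a, psi c a &
    forall y, delta y e -> ~ R3 y (scase e a)]).
  apply: (finish Psi3) => //; apply: (IH3 B c (scase e a)) => //.
  - exact: inset_scase.
  - by move=> v Bv; apply: (decides_cover cR5 dec (inset_scase Be Bv)).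
  - by exists y0.
have [[a [Ba pa ra]]|n4] := pselect (exists a, [/\ inset B a, ~ psi c a &
    forall y, delta y e -> ~ R4 y (scase e a)]).
  apply: (finish Psi4) => //; apply: (IH4 B c (scase e a)) => //.
  - exact: inset_scase.
  - by move=> v Bv; apply: (decides_cover cR6 dec (inset_scase Be Bv)).
  - by exists y0.
apply: (finish Psi0) => //.
have [d Bd dE] := cPsi0 B e Be; exists d => // a Ba; rewrite dE; split=> [pa|].
  case: (decides_cover cR3 dec (inset_scase Be Ba)) => H; first by exists y0; split; [|exact: H].
  by case: n3; exists a; split.
(* Were [psi c a] false, [R4] would hold on all of [delta]; with [R3] at [y] and no demand lowering
   the rank, this gives rank [r.+1]. *)
move=> [y [dy rp]]; apply: contrapT => pa.
case: (decides_cover cR4 dec (inset_scase Be Ba)) => H; last by case: n4; exists a; split.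
apply: (nrk y dy); split; first by exists a => //; split; [exact: rp|exact: (H y dy)].
move=> b _; apply: contrapT => nb; apply: (isbad y dy); exists b; split.
  by move=> rb; apply: nb; left.
by move=> z Pz rz; apply: nb; right; exists z.
Qed.

End Reduction.

(** * Cardinalities *)

Section Cardinals.
Variable L : language.
Notation F := (all_formulas L).
Notation W := (set F).

Fixpoint close n : formula L n -> sentence L :=
  match n with
  | 0 => id
  | n'.+1 => fun phi => close (Fall phi)
  end.

(** Partial inverses of the constructors yield injectivity at a fixed index without equations
    between dependent pairs. *)
Definition unall n (phi : formula L n) : option (formula L n.+1) :=
  match phi in formula _ k return option (formula L k.+1) with
  | Fall _ a => Some a
  | _ => None
  end.

Definition unimp n (phi : formula L n) : option (formula L n * formula L n) :=
  match phi in formula _ k return option (formula L k * formula L k) with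
  | Fimp _ a b => Some (a, b)
  | _ => None
  end.

Lemma close_inj n : injective (@close n).
Proof.
elim: n => [|n IH] //= phi psi /IH /(congr1 (@unall n)) [].
by [].
Qed.

Lemma Fimp_inj n (a b c d : formula L n) : Fimp a b = Fimp c d -> a = c /\ b = d.
Proof. by move=> /(congr1 (@unimp n)) [-> ->]. Qed.

Fixpoint nat_sentence k : sentence L :=
  if k is k'.+1 then Fimp (nat_sentence k') Fbot else Fbot.

Lemma nat_sentence_inj : injective nat_sentence.
Proof.
elim=> [|k IH] [|l] //= /(congr1 (@unimp 0)) //=.
by move=> [/IH ->].
Qed.

Lemma existT0_inj (a b : sentence L) :
  existT (formula L) 0 a = existT (formula L) 0 b -> a = b.
Proof.
pose f (x : F) : sentence L := let: existT n phi := x in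
  (if n is 0 return formula L n -> sentence L then id else fun=> Fbot) phi.
by move=> /(congr1 f).
Qed.

(** Universal closure turns both formulas into sentences but forgets how many free variables they
    had; two numerals record this. *)
Definition pairF (x y : F) : F :=
  existT (formula L) 0 (Fimp (Fimp (nat_sentence (projT1 x)) (nat_sentence (projT1 y)))
    (Fimp (close (projT2 x)) (close (projT2 y)))).

Lemma pairF_inj x y x' y' : pairF x y = pairF x' y' -> x = x' /\ y = y'.
Proof.
move: x y x' y' => [n phi] [m psi] [n' phi'] [m' psi'] /existT0_inj /=.
move=> /Fimp_inj[/Fimp_inj[/nat_sentence_inj + /nat_sentence_inj]].
move=> nn mm; subst n' m'.
by move=> /Fimp_inj[/close_inj -> /close_inj ->].
Qed.

Definition natF k : F := existT (formula L) 0 (nat_sentence k).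

Lemma natF_inj : injective natF.
Proof. by move=> k l /existT0_inj /nat_sentence_inj. Qed.

(* |W| ^ |F| = |W| for W the power set of F, because |F| ^ 2 = |F|. *)
Definition powW (f : F -> W) : W := [set x | exists a b, x = pairF a b /\ f a b].

Lemma powW_inj : injective powW.
Proof.
move=> f g fg; apply: funext => a; apply/seteqP.
split=> b; [have := congr1 (@^~ (pairF a b)) fg | have := congr1 (@^~ (pairF a b)) (esym fg)];
  rewrite /powW /= => E H.
- have : exists a0 b0, pairF a b = pairF a0 b0 /\ f a0 b0 by exists a, b.
  by rewrite E => -[a' [b' [/pairF_inj[<- <-]]]].
- have : exists a0 b0, pairF a b = pairF a0 b0 /\ g a0 b0 by exists a, b.
  by rewrite E => -[a' [b' [/pairF_inj[<- <-]]]].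
Qed.

Definition oneW (x : F) : W := [set x].

Lemma oneW_inj : injective oneW.
Proof. by move=> x y /seteqP[/(_ x erefl)]. Qed.

Definition pairW (x y : W) : W :=
  powW (fun a => if `[< a = natF 0 >] then x else if `[< a = natF 1 >] then y else set0).

Lemma pairW_inj x y x' y' : pairW x y = pairW x' y' -> x = x' /\ y = y'.
Proof.
have n10 : natF 1 <> natF 0 by move=> /natF_inj.
move=> /powW_inj E; split.
  by have := congr1 (@^~ (natF 0)) E; rewrite !asboolT.
have := congr1 (@^~ (natF 1)) E.
by rewrite !(asboolF n10) !asboolT.
Qed.

End Cardinals.

(** * The height of the tree: least failure of smallness along a well-order *)

Section Threshold.
Variable W : choiceType.

(* 2 ^ |D| <= |W| *)
Definition small (D : set W) := exists h : (W -> bool) -> W,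
  forall eta eta', h eta = h eta' -> forall v, D v -> eta v = eta' v.

Lemma small_sub (D E : set W) : D `<=` E -> small E -> small D.
Proof. by move=> DE [h H]; exists h => eta eta' /H K v /DE; apply: K. Qed.

(** Cantor's diagonal argument: [eta0] negates each coded [eta] at its own code, so it cannot have a
    code itself. *)
Lemma not_small_setT : ~ small setT.
Proof.
move=> [h H]; pose eta0 w := `[< exists eta, h eta = w /\ ~~ eta w >].
have [|n0] := boolP (eta0 (h eta0)).
  move=> /[dup] e0 /asboolP[eta [/H E ne]].
  by move: ne; rewrite E // e0.
by move: (n0) => /asboolP; apply; exists eta0.
Qed.

Record wellorder (R : rel W) (bot : W) : Prop := {
  wo_tot : forall x y, R x y || R y x;
  wo_trans : forall x y z, R x y -> R y z -> R x z;
  wo_anti : forall x y, R x y -> R y x -> x = y;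
  wo_bot : forall x, R bot x;
  wo_min : forall A : set W, A !=set0 -> exists2 x, A x & forall y, A y -> R x y }.

Lemma exists_wellorder (w : W) : exists R bot, wellorder R bot.
Proof.
have [R wo] := well_ordering_principle W; exists R.
have min (A : set W) : A !=set0 -> exists2 x, A x & forall y, A y -> R x y.
  move=> [x Ax]; have [|z [[zA zm] _]] := wo (mem A); first by exists x; rewrite inE.
  by exists z; [rewrite inE in zA|move=> y Ay; apply: zm; rewrite inE].
have tot x y : R x y || R y x.
  have [|z] := min [set z | z = x \/ z = y]; first by exists x; left.
  by move=> [] -> H; rewrite ?(H y) ?(H x) ?orbT //; [right|left].
(* Elements below each other are both least in the pair they form, and least elements are unique. *)
have anti x y : R x y -> R y x -> x = y.
  move=> xy yx; have [|z [_ U]] := wo (mem [set z | z = x \/ z = y]).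
    by exists x; rewrite inE; left.
  have refl t : R t t by have := tot t t; rewrite orbb.
  apply: etrans (esym (U x _)) (U y _); split; rewrite ?inE /=; (try by [left|right]);
    by move=> t; rewrite inE => -[] ->.
have [bot _ bm] := min setT (ex_intro _ w I).
exists bot; split=> //.
- move=> x y z xy yz.
  have [|t] := min [set t | [\/ t = x, t = y | t = z]]; first by exists x; constructor 1.
  move=> [] -> H; first by apply: H; constructor 3.
    by have /(anti _ _ xy) -> : R y x by apply: H; constructor 1.
  by have /(anti _ _ yz) <- : R z y by apply: H; constructor 2.
- by move=> x; apply: bm.
Qed.

(** [Lam] collects the [i] up to which all strict initial segments are small. If [Lam] were small,
    the least index outside it would belong to it, so [Lam] would be everything, against Cantor. *)
Lemma exists_threshold R bot : wellorder R bot ->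
  exists Lam : set W, [/\ Lam bot,
    forall i j, Lam i -> R j i -> Lam j,
    forall i, Lam i -> small [set j | R j i && (j != i)] & ~ small Lam].
Proof.
move=> wo; pose below i := [set j | R j i && (j != i)].
have sbot : small (below bot).
  exists (fun=> bot) => ? ? _ v /= /andP[vb /eqP]; case.
  exact: (wo_anti wo vb (wo_bot wo v)).
exists [set i | forall j, R j i -> small (below j)]; split.
- by move=> j /= jb; have -> : j = bot by apply: (wo_anti wo jb (wo_bot wo j)).
- by move=> i j /= Hi ji k kj; apply: Hi; apply: (wo_trans wo kj ji).
- by move=> i; apply; have := wo_tot wo i i; rewrite orbb.
- move=> sL; have [nL|aL] := pselect (exists i, ~ forall j, R j i -> small (below j)).
    have [i /existsNP[j /not_implyP[ji nsj]] im] := wo_min wo nL.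
    apply: nsj; apply: small_sub sL => k /= /andP[kj nkj] l lk.
    apply: contrapT => nl; move/eqP: nkj; apply; apply: (wo_anti wo kj).
    apply: (wo_trans wo ji); apply: im => H.
    by apply: nl; apply: H.
  apply: not_small_setT; apply: small_sub sL => i _ /=.
  by apply: contrapT => ni; apply: aL; exists i.
Qed.

End Threshold.

(** * Realizing limit types *)

Section Pformula.
Variables (L : language) (C : structure L).

(** Passage from [Def] to formulas with parameters: each variable of the formula that is sent into
    [V] gets its own slot in the parameter tuple. *)
Lemma Def_pformula n V (X : ('I_n + V -> C) -> Prop) (v : V -> C) : Def X ->
  exists m (psi : formula L (n + m)) (b : m.-tuple C),
    (forall k, exists j, tnth b k = v j) /\
    forall x : n.-tuple C, sat psi (cat_tuple x b) <-> X (scase (tnth x) v).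
Proof.
move=> [p [phi [f H]]].
have [m [g [h hE]]] : exists m (g : 'I_p -> 'I_(n + m)) (h : 'I_m -> V), forall k,
    match fintype.split (g k) with inl i => f k = inl i | inr j => f k = inr (h j) end.
  have spl m i : fintype.split (lshift m i) = inl i :> 'I_n + 'I_m := unsplitK (inl i).
  have spr m i : fintype.split (rshift n i) = inr i :> 'I_n + 'I_m := unsplitK (inr i).
  elim: p f {phi H} => [|p IH] f.
    have g0 T : 'I_0 -> T by case.
    by exists 0, (g0 _), (g0 _) => -[].
  have [m [g [h hE]]] := IH (f \o lift ord0).
  case f0: (f ord0) => [i|j].
    exists m, (fun k => if unlift ord0 k is Some k' then g k' else lshift m i), h => k.
    case: unliftP => [k'|] -> ; first exact: hE.
    by rewrite spl.
  exists m.+1, (fun k => if unlift ord0 k is Some k' then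
       match fintype.split (g k') with
       | inl i => lshift _ i | inr j => rshift n (lift ord0 j) end
     else rshift n ord0),
    (fun k => if unlift ord0 k is Some k' then h k' else j) => k.
  case: unliftP => [k'|] ->; last by rewrite spr unlift_none.
  by have := hE k'; case: (fintype.split (g k')) => l /=; rewrite ?spl ?spr ?liftK.
exists m, (ren phi g), [tuple v (h j) | j < m]; split.
  by move=> k; exists (h k); rewrite tnth_mktuple.
move=> x; rewrite sat_ren H.
suff -> : [tuple tnth (cat_tuple x [tuple v (h j) | j < m]) (g i) | i < p] =
  [tuple scase (tnth x) v (f i) | i < p] by [].
apply: eq_from_tnth => i; rewrite !tnth_mktuple.
have := hE i; rewrite -{2}(splitK (g i)); case: (fintype.split (g i)) => j -> /=.
  by rewrite tnth_lshift.
by rewrite tnth_rshift tnth_mktuple.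
Qed.

End Pformula.

Section Injections.

Lemma card_le_inj T U (A : set T) (B : set U) (f : T -> U) :
  (forall x, A x -> B (f x)) ->
  (forall x y, A x -> A y -> f x = f y -> x = y) -> A #<= B.
Proof.
move=> fB finj; have fI : {in A &, injective f}.
  by move=> x y; rewrite !inE; apply: finj.
rewrite -(card_le_eql (inj_card_eq fI)); apply: subset_card_le.
by move=> _ [x Ax <-]; apply: fB.
Qed.

Lemma card_le_injP T U (A : set T) (B : set U) (u : U) : A #<= B ->
  exists f : T -> U, (forall x, A x -> B (f x)) /\
    (forall x y, A x -> A y -> f x = f y -> x = y).
Proof.
move=> /card_leP[f].
exists (fun x => if pselect (A x) is left Ax then sval (f (SigSub (mem_set Ax))) else u).
split=> [x Ax|x y Ax Ay]; case: pselect => // Ax'.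
  by case: (f _) => t /=; rewrite inE.
case: pselect => // Ay' /val_inj /inj.
by rewrite !inE => /(_ I I) [].
Qed.

End Injections.

Section Limit.
Variables (L : language) (C : structure L).

(** Finite tuples need no filler value, so [V] may be empty here, in contrast to [Def_exs]. *)
Lemma Def_ex_ord n V (F : ('I_n -> C) -> (V -> C) -> Prop) :
  Def2 F -> Def (fun v => exists x, F x v).
Proof.
elim: n V F => [|n IH] V F HF.
  have g : 'I_0 -> V by case.
  apply: Def_ext (Def2_app g id HF) => v; split=> [H|[x]]; first by exists (v \o g).
  by have -> : x = v \o g by apply: funext => -[].
pose cons (x : 'I_n -> C) z (k : 'I_n.+1) := if unlift ord0 k is Some k' then x k' else z.
apply: (@Def_ext _ _ _ (fun v => exists z x, F (cons x z) v)) => [v|].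
  split=> [[z [x H]]|[x H]]; first by exists (cons x z).
  exists (x ord0), (x \o lift ord0).
  suff -> : cons (x \o lift ord0) (x ord0) = x by [].
  by apply: funext => k; rewrite /cons; case: unliftP => [j|] ->.
apply: Def_ex; apply: (IH _ (fun x u => F (cons x (u None)) (u \o Some))).
apply: Def_ext (Def2_app (fun k => if unlift ord0 k is Some k' then inl k' else inr None)
  (inr \o Some) HF) => u.
suff -> : u \o (fun k => if unlift ord0 k is Some k' then inl k' else inr None) =
  cons (u \o inl) (u (inr None)) by [].
by apply: funext => k; rewrite /cons /=; case: unliftP.
Qed.

Variables (kappa W : Type).
Hypothesis C_saturated : saturated C kappa.
Hypothesis W_kappa : forall A : set C, A #<= [set: W] -> card_lt A [set: kappa].
Variables (I : Type) (U : set_system I) (UF : UltraFilter U).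
Variables (N : Type) (G : I -> N -> C).

Lemma U_const (A : Prop) : U (fun=> A) <-> A.
Proof.
split=> [UA|HA]; last by apply: filterS (filterT); move=> i.
by have [i] := filter_ex UA.
Qed.

Lemma U_not (A : set I) : U (~` A) <-> ~ U A.
Proof.
split=> [UnA UA|nUA]; last by case: (in_ultra_setVsetC A UF).
by have [i []] := filter_ex (filterI UA UnA).
Qed.

(* A graph from N to C is good if it preserves the limit type along U of the
   families (G i n)_n. *)
Definition good (M : set (N * C)) := forall V (X : (V -> C) -> Prop) (v : V -> N * C),
  Def X -> (forall k, M (v k)) ->
  (X (snd \o v) <-> U [set i | X (G i \o fst \o v)]).

(** The limit along [U] of the types of the [x i] is finitely satisfiable: by goodness, an
    existential statement true for [U]-many [i] holds in [C] of the limit parameters. Saturation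
    then applies, the parameters being few. *)
Lemma good_realizes (M : set (N * C)) n (x : I -> 'I_n -> C) :
  good M -> [set c | exists k, M (k, c)] #<= [set: W] ->
  exists c : 'I_n -> C, forall V (X : ('I_n + V -> C) -> Prop) (v : V -> N * C),
    Def X -> (forall k, M (v k)) ->
    (X (scase c (snd \o v)) <-> U [set i | X (scase (x i) (G i \o fst \o v))]).
Proof.
move=> gM /W_kappa ltM; set A := [set c | _] in ltM.
pose p := [set phi : pformula C n | pformula_over A phi /\
  exists V (X : ('I_n + V -> C) -> Prop) (v : V -> N * C), [/\ Def X, forall k, M (v k),
    U [set i | X (scase (x i) (G i \o fst \o v))] &
    forall c, psat phi c <-> X (scase (tnth c) (snd \o v))]].
have pP V (X : ('I_n + V -> C) -> Prop) (v : V -> N * C) : Def X -> (forall k, M (v k)) ->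
    U [set i | X (scase (x i) (G i \o fst \o v))] ->
    exists2 phi, p phi & forall c, psat phi c -> X (scase (tnth c) (snd \o v)).
  move=> HX Mv UX; have [m [psi [b [bv psiE]]]] := Def_pformula (snd \o v) HX.
  exists (PFormula psi b); last by move=> c /psiE.
  split; last by exists V, X, v.
  by move=> k; have [j ->] := bv k; exists (v j).1; rewrite -surjective_pairing.
have [c cP] : exists c, forall phi, p phi -> psat phi c.
  apply: (C_saturated ltM); first by move=> phi [].
  move=> q /(@finite_seqP {classic (pformula C n)})[s ->] sp.
  have [V [X [v [HX Mv UX Xs]]]] : exists V (X : ('I_n + V -> C) -> Prop) (v : V -> N * C),
      [/\ Def X, forall k, M (v k), U [set i | X (scase (x i) (G i \o fst \o v))] &
      forall c : n.-tuple C, X (scase (tnth c) (snd \o v)) ->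
        forall phi : {classic (pformula C n)}, phi \in s -> psat phi c].
    elim: s sp => [|phi s IH] sp.
      by exists void, (fun=> True), (fun k : void => match k with end); split=> //;
        [exact: Def_true|exact/U_const].
    have [|V [X [v [HX Mv UX Xs]]]] := IH.
      by move=> psi ps; apply: sp; rewrite /= in_cons ps orbT.
    have [|_ [V' [X' [v' [HX' Mv' UX' Xphi]]]]] := sp phi; first by rewrite /= mem_head.
    exists (V + V')%type, (fun u => X (scase (u \o inl) (u \o inr \o inl)) /\
      X' (scase (u \o inl) (u \o inr \o inr))), (scase v v'); split.
    - pose f (s : 'I_n + V) : 'I_n + (V + V') :=
        match s with inl k => inl k | inr j => inr (inl j) end.
      pose f' (s : 'I_n + V') : 'I_n + (V + V') :=
        match s with inl k => inl k | inr j => inr (inr j) end.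
      apply: Def_ext (Def_and (Def_ren f HX) (Def_ren f' HX')) => u.
      have -> : u \o f = scase (u \o inl) (u \o inr \o inl) by apply: funext => -[].
      by have -> : u \o f' = scase (u \o inl) (u \o inr \o inr) by apply: funext => -[].
    - by case.
    - exact: filterI UX UX'.
    - by move=> c [Xc X'c] psi; rewrite in_cons => /orP[/eqP ->|/(Xs _ Xc)//]; apply/Xphi.
  have HY : Def (fun w => exists c, X (scase c w)).
    apply: (Def_ex_ord (F := fun c w => X (scase c w))); apply: Def_ext HX => u.
    by have -> : scase (u \o inl) (u \o inr) = u by apply: funext => -[].
  have [c Xc] : exists c, X (scase c (snd \o v)).
    by apply/(gM _ _ _ HY Mv); apply: filterS UX => i Xi; exists (x i).
  exists [tuple c i | i < n] => phi /=; apply: Xs.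
  by have -> : tnth [tuple c i | i < n] = c by apply: funext => i; rewrite tnth_mktuple.
have U2X V (X : ('I_n + V -> C) -> Prop) (v : V -> N * C) : Def X -> (forall k, M (v k)) ->
    U [set i | X (scase (x i) (G i \o fst \o v))] -> X (scase (tnth c) (snd \o v)).
  by move=> HX Mv UX; have [phi /cP phic] := pP V X v HX Mv UX; apply.
exists (tnth c) => V X v HX Mv; split; last exact: U2X.
move=> Xc; apply: contrapT => /U_not nX.
by have := U2X V (fun u => ~ X u) v (Def_not HX) Mv nX; apply.
Qed.

(** A substitute for an ultraproduct inside [C]: a maximal good graph is defined on all of [N],
    since [good_realizes] could extend it by a missing name. *)
Lemma realize_limit : [set: N] #<= [set: W] ->
  exists h : N -> C, forall V (X : (V -> C) -> Prop) (s : V -> N), Def X ->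
    (X (h \o s) <-> U [set i | X (G i \o s)]).
Proof.
move=> cN.
have good0 : good set0.
  move=> V X v HX nv.
  have E w : w = snd \o v by apply: funext => k; case: (nv k).
  have -> : [set i | X (G i \o fst \o v)] = fun=> X (snd \o v).
    by apply: funext => i /=; rewrite (E (G i \o fst \o v)).
  by split=> [H|/U_const //]; apply/U_const.
have [|M [gM Mmax]] := @Zorn_bigcup (N * C)%type good.
  move=> F Fgood Ftot V X v [p [phi [f H]]] Fv.
  pose X' (w : 'I_p -> C) := sat phi [tuple w i | i < p].
  have HX' : Def X' by exists p, phi, id.
  (* A definable relation reads finitely many points of the union of a chain, and these lie in one
     member, or in the empty graph if there are none. *)
  suff [M FM Mv] : exists2 M, F M \/ M = set0 & forall k, M (v (f k)).
    have gM : good M by case: FM => [FM|->] //; exact: Fgood.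
    have := gM _ X' (v \o f) HX' Mv; rewrite /X' H => ->.
    by split; apply: filterS => i /=; rewrite H.
  elim: p f {X' HX' phi H} => [|p IH] f; first by exists set0; [right|case].
  have [M FM Mv] := IH (f \o lift ord0); have [M0 FM0 M0v] := Fv (f ord0).
  have [MM|MM] : M `<=` M0 \/ M0 `<=` M by case: FM => [/(Ftot _ _ FM0)[]|->]; [right|left|left].
    by exists M0; [left|move=> k; case: (unliftP ord0 k) => [j|] -> //; exact/MM/Mv].
  exists M => // k; case: (unliftP ord0 k) => [j|] ->; [exact: Mv|exact: MM].
have dom n : exists c, M (n, c).
  apply: contrapT => nM.
  (* Goodness for equality makes the graph single valued, so distinct values have distinct names. *)
  have cM : [set c | exists k, M (k, c)] #<= [set: W].
    apply: card_le_trans cN.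
    have /choice[g gP] : forall c, exists k, (exists k, M (k, c)) -> M (k, c).
      by move=> c; have [[k Mk]|nk] := pselect (exists k, M (k, c)); [exists k|exists n].
    apply: (card_le_inj (f := g)) => // c d /gP Mc /gP Md gcd.
    have Mv (b : bool) : M (if b then (g c, c) else (g d, d)) by case: b.
    have [_ E] := gM bool _ _ (@Def_eq _ C bool true false) Mv.
    have /E // : U [set i | G i (g c) = G i (g d)].
    by rewrite gcd; apply: filterS filterT => i.
  have [c cP] := good_realizes (n := 1) (fun i _ => G i n) gM cM.
  apply: (Mmax (M `|` [set (n, c ord0)])).
    split; first by left.
    by move=> /(_ (n, c ord0) (or_intror erefl)) Mn; apply: nM; exists (c ord0).
  move=> V X v HX Mv.
  pose V1 := {k | M (v k)}.
  pose f (k : V) : 'I_1 + V1 :=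
    if pselect (M (v k)) is left Mk then inr (exist _ k Mk) else inl ord0.
  have fE : scase c (snd \o (v \o sval)) \o f = snd \o v.
    apply: funext => k; rewrite /f /=; case: pselect => //= nk.
    by case: (Mv k) => // ->.
  have fG i : scase (fun=> G i n) (G i \o fst \o (v \o sval)) \o f = G i \o fst \o v.
    apply: funext => k; rewrite /f /=; case: pselect => //= nk.
    by case: (Mv k) => // ->.
  have := cP _ (fun u => X (u \o f)) (v \o sval) (Def_ren f HX) (fun k => svalP k).
  rewrite fE => ->; split; apply: filterS => i /=; by rewrite fG.
have /choice[h hP] := dom.
exists h => V X s HX.
by have := gM V X (fun k => (s k, h (s k))) HX (fun k => hP (s k)).
Qed.

End Limit.

(** * Satisfaction in subsets, and codes of definable relations *)

Section RelativizedSatisfaction.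
Variables (L : language) (C : structure L).
Implicit Type B : set C.

(** Assignments stay in [C], so that satisfaction in different sets [B] can be compared without
    changing the carrier. *)
Fixpoint rsat B n (phi : formula L n) : n.-tuple C -> Prop :=
  match phi in formula _ n return n.-tuple C -> Prop with
  | Fbot _ => fun=> False
  | Feq _ i j => fun v => tnth v i = tnth v j
  | Frel _ r s => fun v => interp (map_tuple (tnth v) s)
  | Fimp _ phi1 phi2 => fun v => rsat B phi1 v -> rsat B phi2 v
  | Fall _ phi1 => fun v => forall x, B x -> rsat B phi1 (cons_tuple x v)
  end.

Lemma rsatE B n (phi : formula L n) (v : n.-tuple (induced B)) :
  sat phi v <-> rsat B phi (map_tuple sval v).
Proof.
elim: phi v => {n} [n|n i j|n r s|n phi1 IH1 phi2 IH2|n phi1 IH1] v //=.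
- rewrite !tnth_map; split=> [->//|].
  by move: (tnth v i) (tnth v j) => [x Bx] [y By] /= xy; apply: eq_exist.
- suff -> : map_tuple (tnth (map_tuple sval v)) s =
      map_tuple sval (map_tuple (tnth v) s) by [].
  by apply: eq_from_tnth => i; rewrite !tnth_map.
- by rewrite IH1 IH2.
- suff E x : map_tuple sval (cons_tuple x v) = cons_tuple (sval x) (map_tuple sval v).
    split=> [H x Bx|H x]; last by rewrite IH1 E; apply: H; case: x.
    by have := H (exist _ x Bx); rewrite IH1 E.
  apply: eq_from_tnth => i; rewrite tnth_map.
  by case: (unliftP ord0 i) => [j|] ->; rewrite ?tnthS ?tnth0 ?tnth_map.
Qed.

Lemma rsat_holds B (phi : sentence L) : holds (induced B) phi <-> rsat B phi [tuple].
Proof.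
have E (t t' : 0.-tuple C) : t = t' by apply: eq_from_tnth => -[].
by rewrite /holds rsatE (E (map_tuple _ _) [tuple]).
Qed.

Lemma rsat_setT n (phi : formula L n) (v : n.-tuple C) : rsat setT phi v <-> sat phi v.
Proof.
elim: phi v => {n} [n|n i j|n r s|n phi1 IH1 phi2 IH2|n phi1 IH1] v //=.
- by rewrite IH1 IH2.
- by split=> H x => [|_]; apply/IH1/H.
Qed.

Lemma elementary_setT : elementary_submodel (@setT C).
Proof. by move=> n phi a; rewrite rsatE rsat_setT. Qed.

Lemma elem_equiv_two A B : elem_equiv B A -> two A -> two B.
Proof.
move=> BA [p [q [Ap Aq pq]]].
pose phi : sentence L := Fneg (Fall (Fall (Feq L ord0 ord_max))).
have phiE (D : set C) : holds (induced D) phi <-> two D.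
  rewrite rsat_holds /= /tnth /=; split=> [H|[x [y [Dx Dy xy]]] H]; last first.
    by apply: xy; apply: (H y) => //.
  apply: contrapT => n2; apply: H => x Dx y Dy; apply: contrapT => xy.
  by apply: n2; exists y, x.
by apply/phiE/BA/phiE; exists p, q.
Qed.

(** Indexes the definable relations in countably many variables by formulas, so that names can carry
    demands and remain few. Numbers that code no variable are read as [v0]. *)
Definition codeF (V : countType) (v0 : V) (phi : all_formulas L) (v : V -> C) :=
  sat (projT2 phi) [tuple v (odflt v0 (unpickle (i : nat))) | i < projT1 phi].

Lemma Def_codeF (V : countType) (v0 : V) phi : Def (codeF v0 phi).
Proof. by exists (projT1 phi), (projT2 phi), (fun i => odflt v0 (unpickle (i : nat))). Qed.

Lemma codeFP (V : countType) (v0 : V) (X : (V -> C) -> Prop) : Def X ->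
  exists phi, forall v, X v <-> codeF v0 phi v.
Proof.
move=> [p [phi [f H]]]; pose q := \max_(i < p) (pickle (f i)).+1.
have fq i : pickle (f i) < q := leq_bigmax (F := fun i => (pickle (f i)).+1) i.
exists (existT _ q (ren phi (fun i => Ordinal (fq i)))) => v.
rewrite H /codeF /= sat_ren.
suff -> : [tuple v (f i) | i < p] = [tuple tnth
    [tuple v (odflt v0 (unpickle (i : nat))) | i < q] (Ordinal (fq i)) | i < p] by [].
by apply: eq_from_tnth => i; rewrite !tnth_mktuple /= pickleK.
Qed.

End RelativizedSatisfaction.

(** * Finite approximations of the tree of types *)

Section Names.
Variables (L : language) (C : structure L) (P : L).
Notation F := (all_formulas L).
Notation W := (set F : choiceType).
Notation P_ := (@Pset L C P).

Variables (R : rel W) (bot : W) (wo : wellorder R bot).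
Variable Lam : set W.
Hypothesis Lam_bot : Lam bot.
Variable nd : (W -> bool) -> W -> W.
(** [nd eta i] is the node at level [i] of the branch [eta] in the binary tree of height [Lam]. *)
Hypothesis nd_eq : forall eta eta' i,
  (forall j, R j i -> j != i -> eta j = eta' j) -> nd eta i = nd eta' i.
Hypothesis nd_inj : forall eta eta' i, Lam i -> nd eta i = nd eta' i ->
  forall j, R j i -> j != i -> eta j = eta' j.

(* Names for the elements of the set to be built: [Branch i w] names a splitting
   tuple for the node w of level i; [Wit i w e phi t] a witness in P for the demand
   phi(z, x, t), chosen for the branches through the node w of level i which
   continue with e; [Sk phi t] a witness for phi(z, t). The names [Nnil] and
   [Ncons j u t] form lists of parameters. A name denotes an infinite tuple. *)
Inductive name :=
| Nnil
| Ncons (j : nat) (u t : name)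
| Branch (i w : W)
| Wit (i w : W) (e : bool) (phi : F) (t : name)
| Sk (phi : F) (t : name).

HB.instance Definition _ := gen_eqMixin name.

Fixpoint arg (g : name -> nat -> C) (t : name) : nat -> C :=
  match t with
  | Ncons j u t' => fun k => if k is k'.+1 then arg g t' k' else g u j
  | _ => fun=> g Nnil 0
  end.

Definition maxR (i j : W) := if R i j then j else i.

(** Keeps all levels in [Lam]; the conditions attached to an index outside [Lam] are void. *)
Definition clamp (i : W) := if `[< Lam i >] then i else bot.

Fixpoint lev (s : name) : W :=
  match s with
  | Nnil => bot
  | Ncons _ u t => maxR (lev u) (lev t)
  | Branch i _ => clamp i
  | Wit i _ _ _ t => maxR (clamp i) (lev t)
  | Sk _ t => lev t
  end.

Fixpoint nsize (s : name) : nat :=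
  match s with
  | Nnil | Branch _ _ => 0
  | Ncons _ u t => (nsize u + nsize t).+1
  | Wit _ _ _ _ t | Sk _ t => (nsize t).+1
  end.

Lemma R_refl i : R i i.
Proof. by have := wo_tot wo i i; rewrite orbb. Qed.

Lemma R_maxl i j : R i (maxR i j).
Proof. by rewrite /maxR; case: ifP => // _; apply: R_refl. Qed.

Lemma R_maxr i j : R j (maxR i j).
Proof.
rewrite /maxR; case: ifP => H; first exact: R_refl.
by have := wo_tot wo i j; rewrite H.
Qed.

Lemma maxR_ind (Q : W -> Prop) i j : Q i -> Q j -> Q (maxR i j).
Proof. by rewrite /maxR; case: ifP. Qed.

Lemma lev_Lam s : Lam (lev s).
Proof.
have cl i : Lam (clamp i) by rewrite /clamp; case: asboolP.
by elim: s => //= *; apply: maxR_ind.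
Qed.

Lemma clampE i : Lam i -> clamp i = i.
Proof. by move=> Li; rewrite /clamp asboolT. Qed.

(** The condition of a name mentions, besides the name itself, only names from its parameter list,
    which come strictly earlier in this order by level and then size. Reinterpreting a greatest name
    thus leaves the other conditions unchanged. *)
Definition kle (s s' : name) :=
  R (lev s) (lev s') /\ (lev s = lev s' -> (nsize s <= nsize s')%N).

Lemma kle_trans s t u : kle s t -> kle t u -> kle s u.
Proof.
move=> [st st'] [tu tu']; split; first exact: (wo_trans wo st tu).
move=> su; have ts : lev t = lev s by apply: (wo_anti wo _ st); rewrite su.
by apply: leq_trans (st' (esym ts)) (tu' _); rewrite ts.
Qed.

Lemma kle_total s t : kle s t \/ kle t s.
Proof.
have [st|/eqP nst] := eqVneq (lev s) (lev t).
  by rewrite /kle st; case: (leqP (nsize s) (nsize t)) => [H|/ltnW H]; [left|right];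
    split=> //; apply: R_refl.
have /orP[H|H] := wo_tot wo (lev s) (lev t); [left|right]; split=> // E.
by case: nst.
Qed.

Lemma kle_max (S : seq name) : S != [::] -> exists2 s, s \in S & forall t, t \in S -> kle t s.
Proof.
elim: S => // s S IH _; have [->|/IH[m mS mP]] := eqVneq S [::].
  exists s; first exact: mem_head.
  by move=> t; rewrite inE => /eqP ->; split; [apply: R_refl|].
have [sm|ms] := kle_total s m.
  by exists m => [|t]; rewrite inE ?mS ?orbT // => /orP[/eqP -> //|/mP].
exists s => [|t]; rewrite inE ?eqxx // => /orP[/eqP ->|/mP tm].
  by split; [apply: R_refl|].
exact: kle_trans tm ms.
Qed.

Variables (K : finType) (rho : (K -> C) -> (nat -> C) -> Prop).

Definition demandF (phi : F) z (x : K -> C) (b : nat -> C) :=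
  codeF (None : option (K + nat)) phi (ocase z (scase x b)).

Definition skolemF B (phi : F) z (b : nat -> C) :=
  rsat B (projT2 phi) [tuple if i : nat is k.+1 then b k else z | i < projT1 phi].

(** A [Wit] condition binds only if its parameters have level at most [i]; the conditions preceding
    it then depend only on the part of the branch up to [i]. *)
Definition cond g (s : name) (eta : W -> bool) (x : K -> C) : Prop :=
  match s with
  | Branch i w => Lam i -> nd eta i = w -> (rho x (g s) <-> eta i)
  | Wit i w e phi t => Lam i -> nd eta i = w -> eta i = e -> R (lev t) i ->
      (exists z, P_ z /\ demandF phi z x (arg g t)) ->
      P_ (g s 0) /\ demandF phi (g s 0) x (arg g t)
  | _ => True
  end.

(** Skolem conditions for satisfaction in [B]; they carry elementary equivalence over to the
    limit. *)
Definition sk_cond B g (s : name) : Prop :=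
  match s with
  | Sk phi t => (exists z, B z /\ skolemF B phi z (arg g t)) ->
      skolemF B phi (g s 0) (arg g t)
  | _ => True
  end.

Definition upd (g : name -> nat -> C) s a t := if t == s then a else g t.

Lemma arg_upd g s a t : s <> Nnil -> R (lev t) (lev s) ->
  (lev t = lev s -> (nsize t < nsize s)%N) -> arg (upd g s a) t = arg g t.
Proof.
move=> s0; elim: t => [|j u _ t IH|i w|i w e phi t _|phi t _] /=;
  try by rewrite /upd; case: eqP => // /esym.
move=> lt st; have lu := wo_trans wo (R_maxl (lev u) (lev t)) lt.
have lt' := wo_trans wo (R_maxr (lev u) (lev t)) lt.
apply: funext => -[|k].
  rewrite /upd; case: eqP => // us.
  have := st; rewrite us in lt *; move=> /(_ (wo_anti wo lt (R_maxl _ _))).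
  by rewrite ltnNge (leq_trans (leq_addr (nsize t) _)).
rewrite IH //= => ts; apply: leq_ltn_trans (st _); first by rewrite leqW // leq_addl.
by apply: (wo_anti wo lt); rewrite -ts; apply: R_maxr.
Qed.

Variable BB : set (set C).
Hypothesis BB_two : forall B, BB B -> two B.
(** The situation to be refuted: no choice of demands bounds the rank uniformly on [BB]. *)
Hypothesis BB_rank : forall n (E : C -> (K -> C) -> (nat -> C) -> Prop), Def12 E ->
  exists2 B, BB B & rank P B rho E n (fun=> True).

Lemma rankW B E r (X : (K -> C) -> Prop) : rank P B rho E r.+1 X -> rank P B rho E r X.
Proof.
elim: r X => [|r IH] X; first by move=> [[a _ [[x [Xx _]] _]] _]; exists x.
move=> [[a Ba [H1 H2]] H]; split; first by exists a => //; split; apply: IH.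
move=> b /H[/IH|[z [Pz Bz /IH Hz]]]; [by left|right].
by exists z.
Qed.

Lemma cover_demand (E : C -> (K -> C) -> (nat -> C) -> Prop) phi : Def12 E ->
  exists2 E' : C -> (K -> C) -> (nat -> C) -> Prop, Def12 E' & forall B, two B ->
    covers B (fun x : option K -> C => E' (x None) (x \o Some))
             (fun x : option K -> C => E (x None) (x \o Some)) /\
    forall b, inset B b -> exists2 b', inset B b' &
      forall z x, E' z x b' <-> demandF phi z x b.
Proof.
move=> HE.
have HE' : Def2 (fun x : option K -> C => E (x None) (x \o Some)).
  exact: (Def12_app (inl None) (inl \o Some) inr HE).
have Hphi : Def2 (fun x : option K -> C => demandF phi (x None) (x \o Some)).
  pose f (s : option (K + nat)) : option K + nat :=
    match s with None => inl None | Some (inl k) => inl (Some k) | Some (inr j) => inr j end.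
  apply: Def_ext (Def_ren f (Def_codeF C None phi)) => u; rewrite /demandF.
  suff -> : u \o f = ocase (u (inl None)) (scase (u \o inl \o Some) (u \o inr)) by [].
  by apply: funext => -[[]|].
have [Z HZ cZ] := cover_two HE' Hphi.
exists (fun z x => Z (ocase z x)).
  pose f (s : option K + nat) : option (K + nat) :=
    match s with inl None => None | inl (Some k) => Some (inl k) | inr j => Some (inr j) end.
  apply: Def_ext (Def_ren f HZ) => u.
  suff -> : u \o f \o inl = ocase (u None) (u \o Some \o inl) by [].
  by apply: funext => -[].
move=> B /cZ[c1 c2]; split.
  move=> v /c1[e Be E1]; exists e => // x; rewrite -E1.
  by have -> : ocase (x None) (x \o Some) = x by apply: funext => -[].
by move=> b /c2[e Be E2]; exists e => // z x; rewrite E2.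
Qed.

Lemma arg_upd_sub g s a t t' : s <> Nnil -> kle t s -> R (lev t') (lev t) ->
  (nsize t' < nsize t)%N -> arg (upd g s a) t' = arg g t'.
Proof.
move=> s0 [ts ts'] lt st; apply: arg_upd => //; first exact: (wo_trans wo lt ts).
move=> E; apply: leq_trans st (ts' _); apply: (wo_anti wo ts).
by rewrite -E.
Qed.

Lemma cond_upd g s a t : s <> Nnil -> t <> s -> kle t s ->
  cond (upd g s a) t = cond g t.
Proof.
move=> s0 ts kts; have ut : upd g s a t = g t by rewrite /upd; case: eqP.
apply: funext => eta; apply: funext => x; case: t ts kts ut => //=.
  by move=> i w _ _ ->.
move=> i w e phi t _ kts ->; rewrite (@arg_upd_sub g s a _ t s0 kts) //=; exact: R_maxr.
Qed.

Lemma sk_cond_upd B g s a t : s <> Nnil -> t <> s -> kle t s ->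
  sk_cond B (upd g s a) t = sk_cond B g t.
Proof.
move=> s0 ts kts; have ut : upd g s a t = g t by rewrite /upd; case: eqP.
case: t ts kts ut => //= phi t _ kts ->; rewrite (@arg_upd_sub g s a _ t s0 kts) //=; exact: R_refl.
Qed.

(** The node at level [i] determines the branch below [i], so a condition of level at most [i] can
    separate two branches through it only by reading their values at [i], which the disjunction
    excludes. *)
Lemma cond_branch eta eta' i g t x : Lam i -> nd eta i = nd eta' i -> R (lev t) i ->
  (eta i = eta' i \/
   (forall w e phi u, R (lev u) i -> t <> Wit i w e phi u) /\ t <> Branch i (nd eta i)) ->
  cond g t eta x -> cond g t eta' x.
Proof.
move=> Li nn lt ee.
have below j : R j i -> j <> i -> nd eta j = nd eta' j /\ eta j = eta' j.
  move=> ji nji; split; last by apply: (nd_inj Li nn) => //; apply/eqP.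
  apply: nd_eq => k kj nkj; apply: (nd_inj Li nn); first exact: (wo_trans wo kj ji).
  by apply/eqP => ki; rewrite ki in kj; case: nji; apply: (wo_anti wo ji kj).
case: t lt ee => //= [j w lj ee H Lj|j w e phi t lj ee H Lj].
  rewrite clampE // in lj; have [ji|nji] := pselect (j = i); last first.
    by have [<- <-] := below j lj nji; apply: H.
  move: H ee; rewrite ji => H [<-|[_ nw]] nw'; first by apply: H => //; rewrite nn.
  by case: nw; rewrite nn nw'.
rewrite clampE // in lj; have ji := wo_trans wo (R_maxl j (lev t)) lj.
have ti := wo_trans wo (R_maxr j (lev t)) lj.
have [ij|nji] := pselect (j = i); last first.
  by have [<- <-] := below j ji nji; apply: H.
move: H ee; rewrite ij => H [<-|[nW _]]; first by rewrite -nn; apply: H.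
by case: (nW w e phi t).
Qed.

(** One value [a] must serve all branches at once. It is taken from the rank at a single branch
    through the node of [s]; the hypotheses on [Branch] and [Wit] carry the outcome to the other
    branches concerned. *)
Lemma approximation_step B E E' g s n (G : (W -> bool) -> (K -> C) -> Prop) :
  (forall t, inset B (g t)) ->
  covers B (fun x : option K -> C => E' (x None) (x \o Some))
           (fun x : option K -> C => E (x None) (x \o Some)) ->
  (forall b, inset B b -> if s is Wit _ _ _ phi _ then
     exists2 b', inset B b' & forall z x, E' z x b' <-> demandF phi z x b else True) ->
  (forall eta, rank P B rho E' n.+1 (G eta)) ->
  (forall i w, s = Branch i w -> forall eta eta' x, Lam i -> nd eta i = w ->
     nd eta' i = w -> G eta x -> G eta' x) ->
  (forall i w e phi t, s = Wit i w e phi t -> forall eta eta' x, Lam i -> nd eta i = w ->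
     nd eta' i = w -> eta i = e -> eta' i = e -> R (lev t) i -> G eta x -> G eta' x) ->
  (s = Nnil -> False) ->
  exists2 a, inset B a & sk_cond B (upd g s a) s /\
    forall eta, rank P B rho E n (fun x => G eta x /\ cond (upd g s a) s eta x).
Proof.
move=> gB cE Es rk Gsplit Gwit s0.
have us a : upd g s a s = a by rewrite /upd eqxx.
have rkW eta : rank P B rho E n (G eta) := rankW (rank_cover cE (rk eta)).
case: s Es Gsplit Gwit s0 us => [|j u t|i w|i w e phi t|phi t] Es Gsplit Gwit s0 us.
- by case: s0.
- exists (g Nnil) => //=; split=> // eta.
  by apply: rank_mono (rkW eta).
- have [[eta0 [Li e0]]|ne] := pselect (exists eta, Lam i /\ nd eta i = w); last first.
    exists (g Nnil) => //; split=> // eta; apply: rank_mono (rkW eta) => x Gx.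
    by split=> //= Li ew; case: ne; exists eta.
  have [[a Ba [rp rn]] _] := rank_cover cE (rk eta0).
  exists a => //; split=> // eta; rewrite /= us.
  have [ew|nw] := pselect (nd eta i = w); last first.
    by apply: rank_mono (rkW eta) => x Gx; split=> // _ /nw.
  by case ei: (eta i); [apply: rank_mono rp|apply: rank_mono rn] => x [Gx rx];
    split; do ?exact: (Gsplit i w erefl eta0).
- have [[eta0 [Li e0 ee0 lt]]|ne] := pselect (exists eta,
      [/\ Lam i, nd eta i = w, eta i = e & R (lev t) i]); last first.
    exists (g Nnil) => //; split=> // eta; apply: rank_mono (rkW eta) => x Gx.
    by split=> //= Li ew ee lt; case: ne; exists eta.
  have argB a : arg (upd g (Wit i w e phi t) a) t = arg g t.
    apply: (@arg_upd_sub _ _ _ (Wit i w e phi t)) => //=; last exact: R_maxr.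
    by split; [apply: R_refl|].
  have Bt : inset B (arg g t).
    by elim: t {Es Gsplit Gwit s0 us lt argB} => [|j u _ t IH|*|*|*] [|k] //=; exact: gB.
  have [b' Bb' b'E] := Es _ Bt.
  have [_ /(_ b' Bb')] := rk eta0.
  (* Refused or accepted, the demand yields this implication at [eta0]: vacuously, or with [a]
     constantly equal to the witness. *)
  have fin a : inset B a ->
      rank P B rho E n (fun x => G eta0 x /\
        ((exists z, P_ z /\ demandF phi z x (arg g t)) ->
        P_ (a 0) /\ demandF phi (a 0) x (arg g t))) ->
      exists2 a, inset B a & sk_cond B (upd g (Wit i w e phi t) a) (Wit i w e phi t) /\
        forall eta, rank P B rho E n
          (fun x => G eta x /\ cond (upd g (Wit i w e phi t) a) (Wit i w e phi t) eta x).
    move=> Ba rka; exists a => //; split=> // eta; rewrite /= us argB.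
    have [[ew ee]|nw] := pselect (nd eta i = w /\ eta i = e); last first.
      by apply: rank_mono (rkW eta) => x Gx; split=> // _ ew ee; case: nw.
    apply: rank_mono rka => x [Gx H]; split=> //.
    exact: (Gwit i w e phi t erefl eta0).
  case=> [rm|[z [Pz Bz rz]]].
    apply: (fin (g Nnil)) => //; apply: rank_cover cE _; apply: rank_mono rm.
    by move=> x [Gx nz]; split=> // -[z [Pz dz]]; case: nz; exists z; rewrite b'E.
  apply: (fin (fun=> z)) => //; apply: rank_cover cE _; apply: rank_mono rz.
  by move=> x [Gx dz]; split=> // _; split=> //; rewrite -b'E.
- have argB a : arg (upd g (Sk phi t) a) t = arg g t.
    apply: (@arg_upd_sub _ _ _ (Sk phi t)) => //=; last exact: R_refl.
    by split; [apply: R_refl|].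
  have [[z [Bz sz]]|nz] := pselect (exists z, B z /\ skolemF B phi z (arg g t)).
    exists (fun=> z) => //; split=> [|eta]; first by rewrite /= us argB.
    by apply: rank_mono (rkW eta).
  exists (g Nnil) => //; split=> [|eta]; first by rewrite /= us argB.
  by apply: rank_mono (rkW eta).
Qed.

(* The greatest name of S is interpreted last, which costs one unit of rank; its
   demand, if it has one, is added to those of the rank beforehand. *)
Lemma approximation (S : seq name) n E : Def12 E ->
  exists B, BB B /\ exists g, [/\ forall s, inset B (g s),
    forall s, s \in S -> sk_cond B g s &
    forall eta, rank P B rho E n (fun x => forall s, s \in S -> cond g s eta x)].
Proof.
have [m Sm] : exists m, (size S <= m)%N by exists (size S).
elim: m S Sm n E => [|m IH] S Sm n E HE.
  have [B hB rk] := BB_rank n HE; have [p [_ [Bp _ _]]] := BB_two hB.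
  exists B; split=> //; exists (fun _ _ => p).
  have -> : S = [::] by case: S Sm.
  split=> [t k|t|eta]; [exact: Bp|by rewrite in_nil|].
  by apply: rank_mono rk => x _ t; rewrite in_nil.
have [->|/kle_max[s sS smax]] := eqVneq S [::]; first exact: (IH [::]).
pose S' := [seq t <- S | t != s].
have S'm : (size S' <= m)%N.
  rewrite -ltnS; apply: leq_trans Sm; rewrite size_filter -(count_predC (fun t => t != s) S).
  by rewrite -[X in (X < _)%N]addn0 ltn_add2l -has_count; apply/hasP; exists s => //=;
    rewrite negbK.
have S'P t : t \in S' -> [/\ t \in S, t <> s & kle t s].
  by rewrite mem_filter => /andP[/eqP ? tS]; split=> //; apply: smax.
(* [Nnil] carries no condition and supplies the filler in [arg], so its value is left alone. *)
have [s0|s0] := pselect (s = Nnil).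
  have [B [hB [g [gB sk rk]]]] := IH S' S'm n E HE.
  exists B; split=> //; exists g; split=> // [t tS|eta].
    have [->|nt] := eqVneq t s; first by rewrite s0.
    by apply: sk; rewrite mem_filter nt.
  apply: rank_mono (rk eta) => x H t tS.
  have [->|nt] := eqVneq t s; first by rewrite s0.
  by apply: H; rewrite mem_filter nt.
pose phi := if s is Wit _ _ _ phi _ then phi else existT _ 0 Fbot.
have [E' HE' cE'] := cover_demand phi HE.
have [B [hB [g [gB sk rk]]]] := IH S' S'm n.+1 E' HE'.
have [cE Es] := cE' B (BB_two hB).
have [||| |a Ba [ska rka]] := @approximation_step B E E' g s n
    (fun eta x => forall t, t \in S' -> cond g t eta x) gB cE _ rk.
- by move=> b Bb; have := Es b Bb; rewrite /phi; case: (s).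
- move=> i w sE eta eta' x Li ew ew' H t /[dup] tS' /S'P[tS ts kts].
  apply: (@cond_branch eta eta' i) (H t tS') => //; first by rewrite ew.
    by have := kts.1; rewrite sE /= clampE.
  right; split; last by rewrite ew -sE.
  (* A [Wit] name of level [i] has positive size, so it cannot precede the [Branch] name [s] of that
     level. *)
  move=> w' e' phi' u ui tE; have := kts.2; have := kts.1.
  rewrite tE sE /= clampE // => mi /(_ (wo_anti wo mi (R_maxl _ _))).
  by rewrite ltn0.
- move=> i w e phi' u sE eta eta' x Li ew ew' ee ee' ui H t /[dup] tS' /S'P[tS ts kts].
  apply: (@cond_branch eta eta' i) (H t tS') => //; [by rewrite ew| |by left; rewrite ee].
  have := kts.1; rewrite sE /= clampE //.
  by have -> // : maxR i (lev u) = i; rewrite /maxR; case: ifP => // iu; apply: (wo_anti wo).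
- by [].
exists B; split=> //; exists (upd g s a); split.
- by move=> t k; rewrite /upd; case: ifP => _; [exact: Ba|exact: gB].
- move=> t tS; have [->//|nt] := eqVneq t s.
  have tS' : t \in S' by rewrite mem_filter nt.
  by have [_ ts kts] := S'P t tS'; rewrite sk_cond_upd //; apply: sk.
- move=> eta; apply: rank_mono (rka eta) => x [H Hs] t tS.
  have [->//|nt] := eqVneq t s.
  have tS' : t \in S' by rewrite mem_filter nt.
  by have [_ ts kts] := S'P t tS'; rewrite cond_upd //; apply: H.
Qed.

End Names.

(** * Completeness as existence of witnesses in [P] *)

Section Completeness.
Variables (L : language) (C : structure L) (P : L).
Notation P_ := (@Pset L C P).
Implicit Types B S : set C.

Lemma Def_all_ord n V (X : 'I_n -> (V -> C) -> Prop) :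
  (forall i, Def (X i)) -> Def (fun v => forall i, X i v).
Proof.
elim: n X => [|n IH] X HX; first by apply: Def_ext (Def_true _ _) => v; split=> // _ [].
apply: Def_ext (Def_and (HX ord0) (IH _ (fun i => HX (lift ord0 i)))) => v.
split=> [[H0 H1] i|H]; last by split.
by case: (unliftP ord0 i) => [j|] ->.
Qed.

Definition sat_cat n m (psi : formula L (n + m)) (x : 'I_n -> C) (b : 'I_m -> C) :=
  sat psi (cat_tuple [tuple x i | i < n] [tuple b i | i < m]).

Lemma Def_sat_cat n m (psi : formula L (n + m)) : Def2 (sat_cat psi).
Proof.
exists (n + m)%N, psi, (@fintype.split n m) => u; rewrite /sat_cat.
suff -> : cat_tuple [tuple (u \o inl) i | i < n] [tuple (u \o inr) i | i < m] =
  [tuple u (fintype.split i) | i < n + m] by [].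
apply: eq_from_tnth => i; rewrite tnth_mktuple -{1}(splitK i).
by case: (fintype.split i) => j /=; rewrite ?tnth_lshift ?tnth_rshift tnth_mktuple.
Qed.

Lemma sat_catE n m (psi : formula L (n + m)) x b :
  sat psi (cat_tuple x b) <-> sat_cat psi (tnth x) (tnth b).
Proof.
rewrite /sat_cat; have -> : [tuple tnth x i | i < n] = x.
  by apply: eq_from_tnth => i; rewrite tnth_mktuple.
have -> // : [tuple tnth b i | i < m] = b.
by apply: eq_from_tnth => i; rewrite tnth_mktuple.
Qed.

(** One coordinate at a time: a coordinate found in [B] joins the parameters, because [B] is
    contained in [S]. *)
Lemma witnessing_tuple B S n V (X : ('I_n -> C) -> (V -> C) -> Prop) v :
  B `<=` S -> witnessing P B S -> Def2 X -> inset S v ->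
  (exists x, (forall i, P_ (x i)) /\ X x v) ->
  exists x, (forall i, P_ (x i) /\ B (x i)) /\ X x v.
Proof.
move=> BS wB; elim: n V X v => [|n IH] V X v HX Sv [x [Px Xx]].
  by exists x; split=> // -[].
pose cons (y : 'I_n -> C) z (k : 'I_n.+1) := if unlift ord0 k is Some k' then y k' else z.
have consE : cons (x \o lift ord0) (x ord0) = x.
  by apply: funext => k; rewrite /cons; case: unliftP => [j|] ->.
have HX' : Def2 (fun y (u : option V -> C) => X (cons y (u None)) (u \o Some)).
  apply: Def_ext (Def2_app (fun k => if unlift ord0 k is Some k' then inl k' else inr None)
    (inr \o Some) HX) => u.
  suff -> : u \o (fun k => if unlift ord0 k is Some k' then inl k' else inr None) =
    cons (u \o inl) (u (inr None)) by [].
  by apply: funext => k; rewrite /cons /=; case: unliftP.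
have [||z [Pz Bz [y [Py Xy]]]] := wB V (fun z u => exists y : 'I_n -> C,
    (forall i, P_ (y i)) /\ X (cons y z) u) v _ Sv.
- apply: (Def_ex_ord (F := fun y u => (forall i, P_ (y i)) /\ X (cons y _) _)).
  by apply: Def_and HX'; apply: Def_all_ord => i; apply: (Def_P C P (inl i)).
- by exists (x ord0); split=> //; exists (x \o lift ord0); rewrite consE; split=> // i; exact: Px.
have [|t [Pt Xt]] := IH _ _ (ocase z v) HX' (inset_ocase (BS _ Bz) Sv).
  by exists y.
exists (cons t z); split=> // k; rewrite /cons.
by case: unliftP.
Qed.

Lemma witnessing_complete B S : B `<=` S -> witnessing P B S ->
  P_ `&` S = P_ `&` B /\ complete_set P S.
Proof.
move=> BS wB; split.
  apply/seteqP; split=> x [Px]; last by move=> /BS.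
  move=> Sx; have [||z [Pz Bz ->]] := wB unit (fun z v => v tt = z) (fun=> x) _ (fun=> Sx).
  - exact: (@Def_eq _ C (option unit) (Some tt) None).
  - by exists x.
  - by [].
move=> n m psi b Sb [x Px]; rewrite sat_catE => hx.
have [|y [Py Xy]] := witnessing_tuple BS wB (Def_sat_cat psi) Sb.
  by exists (tnth x).
exists [tuple y i | i < n]; last by rewrite sat_catE; rewrite (_ : tnth _ = y) //;
  apply: funext => i; rewrite tnth_mktuple.
by move=> i; rewrite tnth_mktuple; split; [|apply: BS]; have [] := Py i.
Qed.

Lemma complete_witnessing B S : P_ `&` S = P_ `&` B -> complete_set P S ->
  witnessing P B S.
Proof.
move=> PS cS V F v HF Sv [z [Pz Fz]].
have [m [psi [b [bv psiE]]]] := @Def_pformula _ C 1 V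
  (fun u => F (u (inl ord0)) (u \o inr)) v
  (Def_ren (fun o => if o is Some j then inr j else inl ord0) HF).
have [||y Sy] := cS 1%N m psi b.
- by move=> k; have [j ->] := bv k; apply: Sv.
- exists [tuple z | _ < 1]; last by apply/psiE; rewrite /= tnth_mktuple.
  by move=> i; rewrite tnth_mktuple.
move=> /psiE /= Fy; exists (tnth y ord0); have := Sy ord0.
by rewrite PS => -[].
Qed.

End Completeness.

(** * Finiteness of the rank *)

Section FiniteRank.
Variables (L : language) (C : structure L) (P : L) (kappa : Type).
Notation F := (all_formulas L).
Notation W := (set F : choiceType).
Notation P_ := (@Pset L C P).
Hypothesis C_saturated : saturated C kappa.
Hypothesis kappa_large : card_lt [set: W] [set: kappa].

Lemma card_lt_W (A : set C) : A #<= [set: W] -> card_lt A [set: kappa].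
Proof. by move=> AW kA; apply: kappa_large; apply: card_le_trans kA AW. Qed.

Fixpoint name_code (s : name L) : W :=
  match s with
  | Nnil => pairW (oneW (natF L 0)) set0
  | Ncons j u t => pairW (oneW (natF L 1))
      (pairW (oneW (natF L j)) (pairW (name_code u) (name_code t)))
  | Branch i w => pairW (oneW (natF L 2)) (pairW i w)
  | Wit i w e phi t => pairW (oneW (natF L 3))
      (pairW (pairW i w) (pairW (oneW (natF L e)) (pairW (oneW phi) (name_code t))))
  | Sk phi t => pairW (oneW (natF L 4)) (pairW (oneW phi) (name_code t))
  end.

Lemma name_code_inj : injective name_code.
Proof.
have tag k l x y : k <> l -> pairW (oneW (natF L k)) x <> pairW (oneW (natF L l)) y.
  by move=> kl /pairW_inj[/oneW_inj/natF_inj].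
elim=> [|j u IHu t IHt|i w|i w e phi t IHt|phi t IHt]
    [|j' u' t'|i' w'|i' w' e' phi' t'|phi' t'] //=;
  try (by move=> /tag []).
- by move=> /pairW_inj[_ /pairW_inj[/oneW_inj/natF_inj -> /pairW_inj[/IHu -> /IHt ->]]].
- by move=> /pairW_inj[_ /pairW_inj[-> ->]].
- move=> /pairW_inj[_ /pairW_inj[/pairW_inj[-> ->] /pairW_inj[]]].
  move=> /oneW_inj/natF_inj ee /pairW_inj[/oneW_inj -> /IHt ->].
  by case: e e' ee => -[].
- by move=> /pairW_inj[_ /pairW_inj[/oneW_inj -> /IHt ->]].
Qed.

(* nd eta i codes the restriction of eta to the predecessors of i. *)
Lemma exists_nodes (R : rel W) (Lam : set W) :
  (forall i, Lam i -> small [set j | R j i && (j != i)]) ->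
  exists nd : (W -> bool) -> W -> W,
    (forall eta eta' i, (forall j, R j i -> j != i -> eta j = eta' j) ->
       nd eta i = nd eta' i) /\
    (forall eta eta' i, Lam i -> nd eta i = nd eta' i ->
       forall j, R j i -> j != i -> eta j = eta' j).
Proof.
move=> sm.
have /choice[h hP] : forall i, exists h : (W -> bool) -> W, Lam i -> forall eta eta',
    h eta = h eta' -> forall v, R v i && (v != i) -> eta v = eta' v.
  move=> i; have [/sm[h hP]|nL] := pselect (Lam i); first by exists h => _; apply: hP.
  by exists (fun=> i) => /nL.
(* Making [eta] false off the strict predecessors of [i] lets the code depend on the restriction
   alone. *)
exists (fun eta i => h i (fun j => [&& R j i, j != i & eta j])); split.
  move=> eta eta' i E; congr (h i _); apply: funext => j.
  by case ji: (R j i); case: eqVneq => //= nji; apply: E.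
move=> eta eta' i Li /(hP i Li) E j ji nji.
by have := E j; rewrite ji nji /=; apply.
Qed.

(** * The limit set and the realizations of branches over it *)

Section Construction.
Variables (K : finType) (rho : (K -> C) -> (nat -> C) -> Prop).
Variables (R : rel W) (bot : W) (wo : wellorder R bot) (Lam : set W).
Hypothesis Lam_bot : Lam bot.
Variable nd : (W -> bool) -> W -> W.
Variables (A : set C) (Bf : seq (name L) -> set C) (gf : seq (name L) -> name L -> nat -> C).
Variable xf : seq (name L) -> (W -> bool) -> K -> C.
Hypothesis Bf_equiv : forall S, elem_equiv (Bf S) A.
Hypothesis gf_in : forall S s, inset (Bf S) (gf S s).
Hypothesis gf_sk : forall S s, s \in S -> sk_cond (Bf S) (gf S) s.
Hypothesis xf_cond : forall S eta s, s \in S ->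
  cond P R bot Lam nd rho (gf S) s eta (xf S eta).
Variables (U : set_system (seq (name L))) (UF : UltraFilter U).
Hypothesis U_mem : forall s, U [set S | s \in S].
Notation N := (name L * nat)%type.
Definition lim_term S (n : N) := gf S n.1 n.2.
Variable h : N -> C.
Hypothesis hP : forall V (X : (V -> C) -> Prop) (s : V -> N), Def X ->
  (X (h \o s) <-> U [set S | X (lim_term S \o s)]).

Definition lim_set : set C := range h.

Definition names (l : seq N) : name L := foldr (fun n t => Ncons n.2 n.1 t) (Nnil L) l.

Lemma arg_names (g : name L -> nat -> C) l k :
  arg g (names l) k = nth (g (Nnil L) 0) [seq g n.1 n.2 | n <- l] k.
Proof. by elim: l k => [|n l IH] [|k] //=. Qed.

(** The analogue of the theorem of Los for the induced structures, with Skolem names in the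
    universal case. *)
Lemma rsat_lim_set p (phi : formula L p) (t : p.-tuple N) :
  rsat lim_set phi (map_tuple h t) <-> U [set S | rsat (Bf S) phi (map_tuple (lim_term S) t)].
Proof.
have atom q (psi : formula L q) (s : q.-tuple N) : sat psi (map_tuple h s) <->
    U [set S | sat psi (map_tuple (lim_term S) s)].
  have E (f : N -> C) : map_tuple f s = [tuple (f \o tnth s) i | i < q].
    by apply: eq_from_tnth => i; rewrite tnth_map tnth_mktuple.
  rewrite E (hP (X := fun v => sat psi [tuple v i | i < q])).
    by split; apply: filterS => S /=; rewrite E.
  by exists q, psi, id.
elim: phi t => {p} [p|p i j|p r s|p phi1 IH1 phi2 IH2|p phi IH] t /=.
- by split=> // /filter_ex[].
- exact: (atom _ (Feq L i j)).
- exact: (atom _ (Frel s)).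
- rewrite IH1 IH2; split=> [H|UH U1]; last by apply: filterS (filterI UH U1) => S [H]; apply: H.
  have [U1|/(U_not UF _).2 nU1] :=
      pselect (U [set S | rsat (Bf S) phi1 (map_tuple (lim_term S) t)]).
    by apply: filterS (H U1) => S H2 _.
  by apply: filterS nU1 => S n1 /n1.
- have mapE (f : N -> C) n : cons_tuple (f n) (map_tuple f t) = map_tuple f (cons_tuple n t).
    by apply: eq_from_tnth => i; case: (unliftP ord0 i) => [j|] ->;
      rewrite !tnth_map ?tnthS ?tnth0 ?tnth_map.
  split=> [H|UH _ [n _ <-]]; last first.
    rewrite mapE IH; apply: filterS UH => S /=; rewrite -mapE; apply.
    exact: gf_in.
  (* [sk] names a counterexample to [phi] in [Bf S] whenever there is one, so [phi] at [sk] implies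
     [phi] on all of [Bf S]. *)
  pose sk := Sk (existT _ p.+1 (Fneg phi)) (names t).
  have Hsk : rsat lim_set phi (map_tuple h (cons_tuple (sk, 0) t)).
    by rewrite -mapE; apply: H; exists (sk, 0).
  move: Hsk; rewrite IH => Hsk; apply: filterS (filterI Hsk (U_mem sk)) => S [H0 /gf_sk].
  rewrite /= /skolemF /= => skS x Bx; apply: contrapT => nx.
  have E z : [tuple if i : nat is k.+1 then arg (gf S) (names t) k else z | i < p.+1] =
      cons_tuple z (map_tuple (lim_term S) t).
    apply: eq_from_tnth => i; rewrite tnth_mktuple.
    case: (unliftP ord0 i) => [j|] ->; last by rewrite tnth0.
    rewrite tnthS tnth_map /= arg_names (nth_map (sk, 0)); last first.
      by rewrite size_tuple; apply: (ltn_ord j).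
    by rewrite -tnth_nth.
  have /skS : exists z, Bf S z /\ (rsat (Bf S) phi [tuple
      if i : nat is k.+1 then arg (gf S) (names t) k else z | i < p.+1] -> False).
    by exists x; rewrite E.
  by rewrite E; apply; move: H0; rewrite /= -mapE.
Qed.

Lemma lim_set_equiv : elem_equiv lim_set A.
Proof.
move=> phi; rewrite rsat_holds.
have E (f : N -> C) : [tuple] = map_tuple f [tuple] by apply: eq_from_tnth => -[].
rewrite (E h) rsat_lim_set -(U_const UF (holds (induced A) phi)).
by split; apply: filterS => S /=; rewrite -E -rsat_holds Bf_equiv.
Qed.

Lemma card_names : [set: N] #<= [set: W].
Proof.
apply: (card_le_inj (f := fun n : N => pairW (name_code n.1) (oneW (natF L n.2)))) => //.
by move=> [s j] [t k] _ _ /pairW_inj[/name_code_inj /= -> /oneW_inj/natF_inj ->].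
Qed.

Lemma lim_realizer eta : exists x : K -> C, forall V (X : (K + V -> C) -> Prop) (s : V -> N),
  Def X -> (X (scase x (h \o s)) <-> U [set S | X (scase (xf S eta) (lim_term S \o s))]).
Proof.
pose M : set (N * C) := [set nc | h nc.1 = nc.2].
have gM : good U lim_term M.
  move=> V X v HX Mv; rewrite -(hP (fst \o v) HX).
  by have -> : h \o (fst \o v) = snd \o v by apply: funext => k; apply: Mv.
have cM : [set c | exists k, M (k, c)] #<= [set: W].
  have -> : [set c | exists k, M (k, c)] = range h.
    by apply/seteqP; split=> [c [k]|c [k]] ; exists k.
  exact: card_le_trans (card_image_le _ _) card_names.
pose xs S (i : 'I_#|K|) := xf S eta (enum_val i).
have [c cP] := good_realizes C_saturated card_lt_W UF xs gM cM.
exists (c \o enum_rank) => V X s HX.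
pose f (k : K + V) : 'I_#|K| + V := match k with inl i => inl (enum_rank i) | inr j => inr j end.
have := cP V (fun u => X (u \o f)) (fun k => (s k, h (s k))) (Def_ren f HX) (fun k => erefl).
have -> : scase c (snd \o (fun k => (s k, h (s k)))) \o f = scase (c \o enum_rank) (h \o s).
  by apply: funext => -[].
move=> ->; have E S : scase (xs S) (lim_term S \o fst \o
    (fun k => (s k, h (s k)))) \o f = scase (xf S eta) (lim_term S \o s).
  by apply: funext => -[k|k] //=; rewrite /xs enum_rankK.
by split; apply: filterS => S /=; rewrite E.
Qed.

(** A demand with parameters from the limit set and [x] is coded by a formula and a list of names;
    the corresponding [Wit] name on the branch [eta] belongs to [U]-many [S], where it meets the
    demand on [xf S eta]. *)
Lemma lim_witnessing eta x :
  (forall V (X : (K + V -> C) -> Prop) (s : V -> N), Def X ->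
    (X (scase x (h \o s)) <-> U [set S | X (scase (xf S eta) (lim_term S \o s))])) ->
  witnessing P lim_set (lim_set `|` range x).
Proof.
move=> xP V0 F0 v0 HF0 v0S z0.
have /choice[s0 s0P] : forall j, exists s : K + N, v0 j = scase x h s.
  by move=> j; have [[n _ <-]|[k _ <-]] := v0S j; [exists (inr n)|exists (inl k)].
have [p [phi [f fE]]] := HF0.
pose args := [tuple if f i is Some j then if s0 j is inr n then n else (Nnil L, 0)
  else (Nnil L, 0) | i < p].
pose Y (u : option (K + nat) -> C) := sat phi [tuple
  if f i is Some j then if s0 j is inl k then u (Some (inl k)) else u (Some (inr (i : nat)))
  else u None | i < p].
have HY : Def Y.
  exists p, phi, (fun i => if f i is Some j then
    if s0 j is inl k then Some (inl k) else Some (inr (i : nat)) else None) => u.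
  rewrite /Y; suff -> : [tuple if f i is Some j then if s0 j is inl k then u (Some (inl k))
    else u (Some (inr (i : nat))) else u None | i < p] = [tuple u (if f i is Some j then
    if s0 j is inl k then Some (inl k) else Some (inr (i : nat)) else None) | i < p] by [].
  by apply: eq_from_tnth => i; rewrite !tnth_mktuple; case: (f i) => // j; case: (s0 j).
have [psi psiE] := codeFP None HY.
(* The least level that [cond] allows for these parameters. *)
pose i0 := lev R bot Lam (names args).
pose wit := Wit i0 (nd eta i0) (eta i0) psi (names args).
have argE S i : arg (gf S) (names args) (i : 'I_p) = lim_term S (tnth args i).
  by rewrite arg_names (nth_map (Nnil L, 0)) ?size_tuple // -tnth_nth.
have demE S z y : demandF psi z y (arg (gf S) (names args)) <->
    F0 z (fun j => scase y (lim_term S) (s0 j)).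
  rewrite /demandF -psiE /Y (fE (ocase z (fun j => scase y (lim_term S) (s0 j)))).
  set t1 := mktuple _; set t2 := mktuple _; suff -> : t1 = t2 by [].
  apply: eq_from_tnth => i; rewrite !tnth_mktuple.
  case fi: (f i) => [j|] //=; case sj: (s0 j) => [k|n] //=.
  by rewrite argE /args tnth_mktuple fi sj.
have Lwit S z : wit \in S -> P_ z -> F0 z (fun j => scase (xf S eta) (lim_term S) (s0 j)) ->
    P_ (gf S wit 0) /\ F0 (gf S wit 0) (fun j => scase (xf S eta) (lim_term S) (s0 j)).
  move=> /(xf_cond eta) /=; rewrite demE => H Pz Fz; apply: H => //.
  - exact: (lev_Lam R Lam_bot).
  - exact: (R_refl wo).
  - by exists z; rewrite demE.
pose s1 (o : option N) : N := if o is Some n then n else (wit, 0).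
have trans (Z : (K + option N -> C) -> Prop) : Def Z ->
    U [set S | Z (scase (xf S eta) (lim_term S \o s1))] -> Z (scase x (h \o s1)).
  by move=> HZ UZ; apply/xP.
pose v' (o : V0) : K + option N := match s0 o with inl k => inl k | inr n => inr (Some n) end.
have v'x : scase x (h \o s1) \o v' = v0.
  by apply: funext => j; rewrite s0P /v' /=; case: (s0 j).
have v'S S : scase (xf S eta) (lim_term S \o s1) \o v' =
    (fun j => scase (xf S eta) (lim_term S) (s0 j)).
  by apply: funext => j; rewrite /v' /=; case: (s0 j).
have Hz : Def (fun u : K + option N -> C => P_ (u (inr None)) /\ F0 (u (inr None)) (u \o v')).
  apply: Def_and; first exact: (Def_P C P (inr None)).
  exact: (Def_ren (fun o => if o is Some j then v' j else inr None) HF0).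
have Hex : Def (fun u : K + option N -> C => exists z, P_ z /\ F0 z (u \o v')).
  apply: (Def_ex (F := fun z u => P_ z /\ F0 z (u \o v'))).
  apply: Def_and; first exact: (Def_P C P None).
  exact: (Def_ren (fun o => if o is Some j then Some (v' j) else None) HF0).
have Uex : U [set S | exists z, P_ z /\ F0 z (scase (xf S eta) (lim_term S \o s1) \o v')].
  by apply/(xP _ _ s1 Hex); rewrite v'x.
have [Pw Fw] : P_ (h (wit, 0)) /\ F0 (h (wit, 0)) (scase x (h \o s1) \o v').
  apply: (trans _ Hz); apply: filterS (filterI Uex (U_mem wit)) => S [[z [Pz Fz]] Sw].
  by rewrite /= v'S; apply: (Lwit S z Sw Pz); rewrite -v'S.
by exists (h (wit, 0)); split=> //; [exists (wit, 0)|rewrite -v'x].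
Qed.

End Construction.

Lemma tp_Def (K : finType) (A : set C) (x y : K -> C) V (X : (K -> C) -> (V -> C) -> Prop) v :
  Def2 X -> inset A v ->
  tp [tuple x (enum_val i) | i < #|K|] A = tp [tuple y (enum_val i) | i < #|K|] A ->
  X x v -> X y v.
Proof.
move=> HX Av xy.
have [m [psi [b [bv psiE]]]] := Def_pformula v (Def2_app (inl \o enum_rank) inr HX).
have tE (z : K -> C) : tnth [tuple z (enum_val i) | i < #|K|] \o enum_rank = z.
  by apply: funext => k /=; rewrite tnth_mktuple enum_rankK.
have xz : (tp [tuple x (enum_val i) | i < #|K|] A (PFormula psi b) ->
    tp [tuple y (enum_val i) | i < #|K|] A (PFormula psi b)) by rewrite xy.
have E (z : K -> C) : sat psi (cat_tuple [tuple z (enum_val i) | i < #|K|] b) <-> X z v.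
  by rewrite psiE -[in X in _ <-> X](tE z).
move=> /E Xx; apply/E; suff /xz[_] : tp [tuple x (enum_val i) | i < #|K|] A (PFormula psi b) by [].
by split=> // k; have [j ->] := bv k; apply: Av.
Qed.

(* Otherwise the tree of all branches of length Lam, where 2 ^ i <= 2 ^ |F| for i in
   Lam but not for Lam, can be realized over a set lim_set of cardinality at most
   2 ^ |F|, itself elementarily equivalent to A: this gives too many types. *)
Theorem finite_rank (A : set C) (K : finType) (rho : (K -> C) -> (nat -> C) -> Prop) :
  stable P A -> two A -> Def2 rho ->
  exists n (E : C -> (K -> C) -> (nat -> C) -> Prop), Def12 E /\
    forall B, elem_equiv B A -> ~ rank P B rho E n (fun=> True).
Proof.
move=> [_ stA] tA Hrho; apply: contrapT => nH.
have BBr n E : Def12 E -> exists2 B : set C, elem_equiv B A &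
    rank P B rho E n (fun=> True).
  move=> HE; apply: contrapT => nB; apply: nH; exists n, E; split=> // B BA rk.
  by apply: nB; exists B.
have [R [bot wo]] := exists_wellorder (set0 : W).
have [Lam [Lam_bot Lam_down Lam_small Lam_large]] := exists_threshold wo.
have [nd [nd_eq nd_inj]] := exists_nodes Lam_small.
have BB_two B : elem_equiv B A -> two B by move=> BA; apply: elem_equiv_two tA.
(* A trivial demand and rank 0 suffice to start: only consistency of the conditions on each branch
   is wanted. *)
have HE0 : Def12 (fun (_ : C) (_ : K -> C) (_ : nat -> C) => True) by exact: Def_true.
have /choice[Bf BfP] := fun S => approximation wo nd_eq nd_inj BB_two BBr S 0 HE0.
have Bf_equiv S := (BfP S).1.
have /choice[gf gfP] := fun S => (BfP S).2.
have gf_in S := let: And3 H _ _ := gfP S in H.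
have gf_sk S := let: And3 _ H _ := gfP S in H.
have /choice[xf xf_cond] : forall S, exists x : (W -> bool) -> K -> C, forall eta s,
    s \in S -> cond P R bot Lam nd rho (gf S) s eta (x eta).
  move=> S; have /choice[x xP] := let: And3 _ _ H := gfP S in H.
  by exists x => eta; apply: xP.
have [U [UF U_mem]] : exists U : set_system (seq (name L)),
    UltraFilter U /\ forall s, U [set S | s \in S].
  pose F0 : set_system (seq (name L)) :=
    [set X | exists S0 : seq (name L), forall S : seq (name L), {subset S0 <= S} -> X S].
  have F0P : ProperFilter F0.
    split=> [[S0 /(_ S0)]|]; first by apply.
    split=> [|X Y [S HX] [T HY]|X Y XY [S HX]].
    - by exists [::].
    - exists (S ++ T) => Z ST; split; [apply: HX|apply: HY] => s sS; apply: ST;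
        by rewrite mem_cat sS ?orbT.
    - by exists S => T ST; apply/XY/HX.
  have [U [UF FU]] := ultraFilterLemma F0P; exists U; split=> // s.
  by apply: FU; exists [:: s] => S sS; apply: sS; rewrite inE.
have [h hP] := realize_limit C_saturated card_lt_W UF (lim_term gf) card_names.
have /choice[x xP] := lim_realizer xf UF hP.
have wit eta := lim_witnessing wo Lam_bot xf_cond UF U_mem (xP eta).
pose A' := lim_set h; pose c eta := [tuple x eta (enum_val i) | i < #|K|].
have cE eta : range (tnth (c eta)) = range (x eta).
  apply/seteqP; split=> [_ [i _ <-]|_ [k _ <-]].
    by rewrite tnth_mktuple; exists (enum_val i).
  by exists (enum_rank k); rewrite // tnth_mktuple enum_rankK.
pose p eta : {n : nat & set (pformula C n)} := existT _ #|K| (tp (c eta) A').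
have pS eta : Sstar P A' (p eta).
  have [PA cA] := witnessing_complete (@subsetUl _ A' _) (wit eta).
  split; last by exists #|K|, (c eta); rewrite cE.
  have wA : witnessing P A' A'.
    by move=> V X v HX Av; apply: (wit eta) => // j; left; apply: Av.
  by have [] := witnessing_complete (@subset_refl _ A') wA.
have [f [fA fI]] := card_le_injP (fun=> h (Nnil L, 0))
  (stA _ (lim_set_equiv Bf_equiv gf_in gf_sk UF U_mem hP)).
have /choice[nm nmP] : forall a, exists n, A' a -> h n = a.
  by move=> a; have [[n _ <-]|na] := pselect (A' a); [exists n|exists (Nnil L, 0)].
have [enc [_ encI]] := card_le_injP (set0 : W) card_names.
(* A function from formulas to [A'] is coded in [W] through names and [powW]; if equal codes forced
   branches to agree on [Lam], then [Lam] would be small. *)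
apply: Lam_large; exists (fun eta => powW (fun phi => enc (nm (f (p eta) phi)))).
move=> eta eta' /powW_inj ee.
have fe : f (p eta) = f (p eta').
  apply: funext => phi; have /encI := congr1 (@^~ phi) ee => /(_ I I) /(congr1 h).
  by rewrite !nmP //; apply: fA (pS _) _ _; exists phi.
have tpE : tp (c eta) A' = tp (c eta') A'.
  exact: (eq_from_Tagged (fI _ _ (pS _) (pS _) fe)).
apply: contrapT => /existsNP[v0 /not_implyP[Lv0 nv0]].
(* At the least level where the branches differ they still share a node, and the tuple named by
   [Branch] at that node separates their [rho]-types. *)
have [i [Li ni] imin] := wo_min wo (ex_intro (fun v => Lam v /\ eta v <> eta' v) v0 (conj Lv0 nv0)).
have nn : nd eta i = nd eta' i.
  apply: nd_eq => j ji nji; apply: contrapT => ej; move/eqP: nji; apply.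
  by apply: (wo_anti wo ji); apply: imin; split=> //; apply: Lam_down ji.
pose b := Branch i (nd eta i); pose s (k : nat) := (b, k).
have rE eta0 : nd eta0 i = nd eta i -> (rho (x eta0) (h \o s) <-> eta0 i).
  move=> e0; split=> [/(xP eta0 _ _ s Hrho) Ur|e1].
    have [S [rS /(xf_cond S eta0) /(_ Li e0) <-]] := filter_ex (filterI Ur (U_mem b)).
    exact: rS.
  apply/(xP eta0 _ _ s Hrho); apply: filterS (U_mem b) => S bS.
  by have /(_ Li e0) := xf_cond S eta0 b bS; move=> H; apply/H.
apply: ni; apply/idP/idP => H.
  by apply/(rE eta' (esym nn)); apply: (tp_Def Hrho _ tpE); [move=> k; exists (s k)|apply/rE].
by apply/(rE eta erefl); apply: (tp_Def Hrho _ (esym tpE)); [move=> k; exists (s k)|apply/rE].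
Qed.

End FiniteRank.

(** * The defining formulas *)

Section Conclusion.
Variables (L : language) (C : structure L).

Lemma Def_sat_params m (Y : ('I_m -> C) -> (nat -> C) -> Prop) : Def2 Y ->
  exists k (phi : formula L (m + k)), forall (a : m.-tuple C) (d : nat -> C),
    Y (tnth a) d <-> sat phi (cat_tuple a [tuple d (j : nat) | j < k]).
Proof.
move=> [p [phi [f H]]].
(* The largest parameter index that occurs; [k.+1] parameters keep [inord] meaningful even if none
   occurs. *)
pose k := (\max_(i < p) if f i is inr l then l else 0).
pose g i : 'I_(m + k.+1) :=
  match f i with inl j => lshift k.+1 j | inr l => rshift m (inord l) end.
exists k.+1, (ren phi g) => a d; rewrite sat_ren.
have -> : Y (tnth a) d <-> sat phi [tuple scase (tnth a) d (f i) | i < p].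
  exact: (H (scase (tnth a) d)).
suff -> : [tuple tnth (cat_tuple a [tuple d (j : nat) | j < k.+1]) (g i) | i < p] =
  [tuple scase (tnth a) d (f i) | i < p] by [].
apply: eq_from_tnth => i; rewrite !tnth_mktuple /g.
case fi: (f i) => [j|l] /=; first by rewrite tnth_lshift.
rewrite tnth_rshift tnth_mktuple inordK // ltnS.
by have := leq_bigmax (F := fun i => if f i is inr l then l else 0) i; rewrite fi.
Qed.

End Conclusion.

Theorem theorem4p1 (L : language) (T : set (sentence L)) (P : L)
    (C : structure L) (kappa : Type)
    (hP : arity P = 1%N)
    (hT : complete_theory T)
    (hQE : quantifier_elimination T)
    (hC : monster C kappa T)
    (H1 : P_relations_definable C P)
    (H2 : types_over_P_definable C P)
    (H3 : models_stable C P)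
    (A : set C) (hA : stable P A) (hA2 : exists a b, [/\ A a, A b & a <> b]) :
  forall n m (psi : formula L (n + m)),
  exists k (Psi : formula L (m + k)), qfree Psi /\
    forall B : set C, elem_equiv B A ->
    forall p : set (pformula C n), Sstar P B (existT _ n p) ->
      exists d : k.-tuple C, tuple_in B d /\ defines B Psi d p psi.
Proof.
move=> n m psi; have [C_model kappa_large C_sat _] := hC.
have twoT : two (@setT C) by have [a [b [_ _ ab]]] := hA2; exists a, b.
pose psi' (x : 'I_n -> C) (a : nat -> C) := sat_cat psi x (fun j : 'I_m => a j).
have Hpsi : Def2 psi'.
  exact: (Def2_app inl (fun j : 'I_m => inr (j : nat)) (Def_sat_cat C psi)).
(* By (H3) the finiteness theorem applies to [C] itself and bounds the rank of [psi] computed in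
   [C]. *)
have [r [D [HD rkD]]] :=
  finite_rank C_sat kappa_large (H3 setT (@elementary_setT _ C)) twoT Hpsi.
have BB_two B : elem_equiv B A -> two B by move=> BA; apply: elem_equiv_two hA2.
(* The reduction starts from the set of all tuples, which has no unknown parameters: hence ['I_0],
   and [True] for both [G] and [delta]. *)
have [rho _ /(_ (fun _ _ => True) (Def_true _ _))[Psi HPsi PsiP]] :=
  @reduction _ _ P _ _ _ Hpsi HD [set B | elem_equiv B A] BB_two
    (fun K rho Hrho => finite_rank C_sat kappa_large hA hA2 Hrho)
    r 'I_0 nat 0 (fun _ _ _ => True) (Def_true _ _).
(* The finite tuple [a] is prolonged by [d 0], which lies in [B] when [d] does. *)
pose Y (a : 'I_m -> C) (d : nat -> C) :=
  Psi (fun j => if insub j is Some i then a i else d 0) d.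
have HY : Def2 Y.
  apply: Def_ext (Def2_app (fun j => if insub j is Some i then inl i else inr 0) inr HPsi) => u.
  suff -> : u \o (fun j => if insub j is Some i then inl i else inr 0) =
    (fun j => if insub j is Some i then (u \o inl) i else (u \o inr) 0) by [].
  by apply: funext => j /=; case: insub.
have [k [Phi PhiY]] := Def_sat_params HY.
have [theta qtheta thetaP] := hQE _ Phi.
exists k, theta; split=> // B BA p [cB [n' [c [PBc cBc pE]]]].
have nn : n' = n := esym (congr1 (@projT1 _ _) pE).
subst n'; have Ep := eq_from_Tagged pE; subst p.
have [d Bd dP] : exists2 d, inset B d & forall a, inset B a -> (psi' (tnth c) a <-> Psi a d).
  have [q [_ [Bq _ _]]] := BB_two B BA.
  apply: (PsiP B (tnth c) (fun=> q)) => //.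
  - exact: (complete_witnessing erefl cB).
  - exact: (complete_witnessing PBc cBc).
  (* There is only one empty tuple, so [True] decides every relation on it. *)
  - move=> v _; have u0 (x y : 'I_0 -> C) : x = y by apply: funext => -[].
    by have [H|H] := pselect (rho (fun=> q) v); [left|right] => x _; rewrite (u0 x (fun=> q)).
  - by move=> _ _; apply: rkD.
exists [tuple d (j : nat) | j < k]; split; first by move=> j; rewrite tnth_mktuple.
have psiE a : tuple_in B a -> (sat psi (cat_tuple c a) <->
    sat theta (cat_tuple a [tuple d (j : nat) | j < k])).
  move=> Ba; rewrite -thetaP // -PhiY sat_catE /Y.
  rewrite -dP => [|j]; last by case: insubP => [i _ _|_]; [apply: Ba|apply: Bd].
  rewrite /psi'; suff -> : (fun j : 'I_m => if insub (j : nat) is Some i then tnth a i else d 0)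
    = tnth a by [].
  by apply: funext => j; rewrite valK.
apply/seteqP; split=> [phi [[Bphi sphi] [b []]]|phi].
- move=> E; move: Bphi sphi; rewrite E /psat /= => Bb /psiE sb.
  by left; exists b => //; split=> //; apply: sb.
- move=> E; move: Bphi sphi; rewrite E /psat /= => Bb nsb.
  by right; exists b => //; split=> //; rewrite -psiE.
- move=> [[b [Bb sb] <-]|[b [Bb sb] <-]].
    by split; [split=> //; apply/psiE|exists b; left].
  by split; [split=> // /psiE sb'; apply: sb; exact: sb'|exists b; right].
Qed.
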